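(* Let $\alpha\in(0,\pi)$, $c_1=\cot\alpha$, $c_2=\csc\alpha$, $C_{\alpha,\mu}=e^{i(1+\mu)(\pi/2-\alpha)}/\sin\alpha$. Assume that $f\in\mathcal{K}'_\mu(\mathbb{R}_+)$ can be decomposed as $f=g+h$, where $h\in\mathcal{E}'(\mathbb{R}_+)$ is of order $r$, where $\mu\ge1/2$ and $\eta\in\mathbb{R}$ are such that $3/2+r<\eta<2+\mu$, and where $g$ is a measurable function on $\mathbb{R}_+$ that is Lebesgue integrable on every interval $X<x<\infty$ ($X>0$) and satisfies: (i) $g(x)\to0$ as $x\to\infty$; (ii) $x^{\eta-1/2}g(x)$ is absolutely continuous on $0\le x<\infty$. Let $\rho\in\mathbb{C}$ be defined by $$\lim_{x\to0^+}e^{-\frac i2x^2c_1}x^{\eta-\frac12}g(x)=\rho\,\frac{c_2^{\frac32-\eta}}{C_{\alpha,\mu}} .$$ Then $$\lim_{\xi\to\infty}e^{i\xi^2c_1/2}\,\xi^{3/2-\eta}\,H_\mu^\alpha f(\xi)=\rho\,H(\mu,\eta),\qquad H(\mu,\eta)=\frac{\Gamma(1+\mu/2-\eta/2)}{2^{\eta-1}\Gamma(\mu/2+\eta/2)} .$$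
   Context: $\mathbb{R}_+=(0,\infty)$, $\mathbb{N}_0=\{0,1,2,\dots\}$, $D=d/dx$. For $\mu\ge-1/2$, $\mathcal{K}_\mu(\mathbb{R}_+)$ is the space of smooth $\varphi:\mathbb{R}_+\to\mathbb{C}$ with $\gamma^\mu_{m,k}(\varphi)=\sup_{x>0}|x^m(x^{-1}D)^k(x^{-\mu-1/2}\varphi(x))|<\infty$ for all $m,k\in\mathbb{N}_0$, with the Fréchet topology given by the norms $\gamma^\mu_r(\varphi)=\max_{0\le m,k\le r}\gamma^\mu_{m,k}(\varphi)$. $\mathcal{K}'_\mu(\mathbb{R}_+)$ is its topological dual. Locally integrable functions $g$ of slow growth at infinity with $x^{\mu+1/2}g(x)$ integrable on $(0,1)$ are identified with elements of $\mathcal{K}'_\mu(\mathbb{R}_+)$ via $\langle g,\varphi\rangle=\int_0^\infty g(x)\varphi(x)\,dx$. $\mathcal{E}'(\mathbb{R}_+)$ is the space of distributions with compact support in $\mathbb{R}_+$ (the dual of $\mathcal{E}(\mathbb{R}_+)=C^\infty(\mathbb{R}_+)$); its elements are elements of $\mathcal{K}'_\mu(\mathbb{R}_+)$. The order of $h\in\mathcal{E}'(\mathbb{R}_+)$ is the smallest $r\in\mathbb{N}_0$ for which there is a constant $C$ with $|\langle h,\varphi\rangle|\le C\sup_{x\in\mathbb{R}_+}|D_x^r\varphi(x)|$ for all $\varphi\in\mathcal{D}(\mathbb{R}_+)$, where $\mathcal{D}(\mathbb{R}_+)$ is the space of smooth functions with compact support in $\mathbb{R}_+$. Fractional Hankel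 transform (FrHT): with $$K_\alpha(x,\xi)=C_{\alpha,\mu}e^{-i\frac{x^2+\xi^2}{2}c_1}\sqrt{x\xi c_2}\,J_\mu(x\xi c_2),$$ which for $\alpha=\pi/2$ is $\sqrt{x\xi}J_\mu(x\xi)$ ($J_\mu$ the Bessel function of the first kind of order $\mu$), a function $g$ has FrHT $H_\mu^\alpha g(\xi)=\int_0^\infty K_\alpha(x,\xi)g(x)\,dx$, $\xi\in\mathbb{R}_+$. On $\mathcal{K}'_\mu(\mathbb{R}_+)$ the FrHT is defined by $\langle H_\mu^\alpha f,\varphi\rangle=\langle f,H_\mu^\alpha\varphi\rangle$, $\varphi\in\mathcal{K}_\mu(\mathbb{R}_+)$. For $h\in\mathcal{E}'(\mathbb{R}_+)$ the FrHT is the smooth function $H_\mu^\alpha h(\xi)=\langle h(x),K_\alpha(x,\xi)\rangle$, $\xi\in\mathbb{R}_+$. Thus for $f=g+h$ as in the claim, $H_\mu^\alpha f(\xi)=\int_0^\infty K_\alpha(x,\xi)g(x)\,dx+\langle h(x),K_\alpha(x,\xi)\rangle$. *)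

(* Defs.v *)
From mathcomp Require Import all_boot all_order all_algebra.
From mathcomp.real_closed Require Export complex.
From mathcomp Require Import all_classical all_reals all_analysis.

Set Implicit Arguments.
Unset Strict Implicit.
Unset Printing Implicit Defensive.

Import Order.TTheory GRing.Theory Num.Theory.
Import numFieldNormedType.Exports.

Local Open Scope classical_set_scope.
Local Open Scope ring_scope.
Local Open Scope complex_scope.

(* Functions on (0, oo) are represented by functions on R of which only the
   restriction to [Rplus] matters. *)
Definition Rplus (R : realType) : set R := `]0, +oo[.

Definition expi (R : realType) (t : R) : R[i] := cos t +i* sin t.

Definition cintegrable (R : realType) (A : set R) (g : R -> R[i]) : Prop :=
  (@lebesgue_measure R).-integrable A (EFin \o (@complex.Re R \o g)) /\
  (@lebesgue_measure R).-integrable A (EFin \o (@complex.Im R \o g)).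

Definition cmeasurable (R : realType) (A : set R) (g : R -> R[i]) : Prop :=
  measurable_fun A (@complex.Re R \o g) /\
  measurable_fun A (@complex.Im R \o g).

Definition cintegral (R : realType) (A : set R) (g : R -> R[i]) : R[i] :=
  (\int[@lebesgue_measure R]_(x in A) complex.Re (g x)) +i*
  (\int[@lebesgue_measure R]_(x in A) complex.Im (g x)).

(* R[i] is a normed module over itself but not over R in the library, so the
   derivatives of phi : R -> R[i] are taken on the real and imaginary parts. *)
Definition Dn (R : realType) (k : nat) (phi : R -> R[i]) (x : R) : R[i] :=
  derive1n k (@complex.Re R \o phi) x +i* derive1n k (@complex.Im R \o phi) x.

Definition smooth (R : realType) (phi : R -> R[i]) : Prop :=
  forall (k : nat) (x : R), Rplus x ->
    derivable (derive1n k (@complex.Re R \o phi)) x 1 /\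
    derivable (derive1n k (@complex.Im R \o phi)) x 1.

Definition supnorm (R : realType) (A : set R) (phi : R -> R[i]) : \bar R :=
  ereal_sup [set (Normc.normc (phi x))%:E | x in A].

(* The dual of a space V of functions whose topology is given by an increasing
   sequence of (semi)norms [p]: the linear functionals that are continuous at
   every point of V. *)
Definition in_dual (R : realType) (V : set (R -> R[i]))
    (p : nat -> (R -> R[i]) -> \bar R) (u : (R -> R[i]) -> R[i]) : Prop :=
  (forall (c : R[i]) (phi psi : R -> R[i]), V phi -> V psi ->
     u (fun x => c * phi x + psi x) = c * u phi + u psi) /\
  (forall phi : R -> R[i], V phi -> forall eps : R, 0 < eps ->
     exists (r : nat) (delta : R), 0 < delta /\
       forall psi : R -> R[i], V psi ->
         (p r (fun x => psi x - phi x)%R < delta%:E)%E ->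
         Normc.normc (u psi - u phi) < eps).

Definition invxD (R : realType) (phi : R -> R[i]) (x : R) : R[i] :=
  (x^-1)%:C * Dn 1 phi x.

Definition gamma_mk (R : realType) (mu : R) (m k : nat)
    (phi : R -> R[i]) : \bar R :=
  supnorm (@Rplus R) (fun x => (x ^+ m)%:C *
    iter k (@invxD R) (fun y => (y `^ (- mu - 2^-1))%:C * phi y) x).

Definition gamma_r (R : realType) (mu : R) (r : nat)
    (phi : R -> R[i]) : \bar R :=
  \big[maxe/0%E]_(i : 'I_r.+1 * 'I_r.+1) gamma_mk mu i.1 i.2 phi.

Definition Kspace (R : realType) (mu : R) : set (R -> R[i]) :=
  [set phi | smooth phi /\ forall m k : nat, (gamma_mk mu m k phi < +oo)%E].

Definition Kdual (R : realType) (mu : R) : set ((R -> R[i]) -> R[i]) :=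
  [set u | in_dual (Kspace mu) (gamma_r mu) u].

(* The topology of E(R_+) = C^oo(R_+) is uniform convergence of all derivatives
   on compact sets; the intervals [1/(n+1), n+1] exhaust R_+. *)

Definition Enorm (R : realType) (n : nat) (phi : R -> R[i]) : \bar R :=
  \big[maxe/0%E]_(k < n.+1) supnorm `[n.+1%:R^-1, n.+1%:R] (Dn k phi).

Definition Edual (R : realType) : set ((R -> R[i]) -> R[i]) :=
  [set h | in_dual (@smooth R) (@Enorm R) h].

Definition Dspace (R : realType) : set (R -> R[i]) :=
  [set phi | smooth phi /\ exists K : set R,
     [/\ compact K, K `<=` @Rplus R
       & forall x, Rplus x -> ~ K x -> phi x = 0]].

Definition order_bound (R : realType) (h : (R -> R[i]) -> R[i])
    (r : nat) : Prop :=
  exists C : R, forall phi : R -> R[i], Dspace phi ->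
    ((Normc.normc (h phi))%:E <= C%:E * supnorm (@Rplus R) (Dn r phi))%E.

Definition has_order (R : realType) (h : (R -> R[i]) -> R[i])
    (r : nat) : Prop :=
  order_bound h r /\ forall s : nat, order_bound h s -> (r <= s)%N.

Definition abs_continuous (R : realType) (I : set R) (F : R -> R[i]) : Prop :=
  forall eps : R, 0 < eps -> exists delta : R, 0 < delta /\
    forall (n : nat) (a b : 'I_n -> R),
      (forall i, [/\ I (a i), I (b i) & a i <= b i]) ->
      trivIset setT (fun i => `]a i, b i[%classic) ->
      \sum_(i < n) (b i - a i) < delta ->
      \sum_(i < n) Normc.normc (F (b i) - F (a i)) < eps.

(* Euler's integral; this is Gamma(s) for s > 0 only, the range in which it is
   used here. *)
Definition Gamma (R : realType) (s : R) : R :=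
  \int[@lebesgue_measure R]_(x in @Rplus R) (x `^ (s - 1) * expR (- x)).

(* Bessel function of the first kind, at t > 0 and for mu > -1. *)
Definition besselJ (R : realType) (mu t : R) : R :=
  limn (series (fun k : nat =>
    (-1) ^+ k / (k`!%:R * Gamma (k%:R + mu + 1)) *
    (t / 2) `^ (k%:R *+ 2 + mu))).

Definition c1 (R : realType) (alpha : R) : R := cos alpha / sin alpha.

Definition c2 (R : realType) (alpha : R) : R := (sin alpha)^-1.

Definition Calpha (R : realType) (alpha mu : R) : R[i] :=
  expi ((1 + mu) * (pi / 2 - alpha)) / (sin alpha)%:C.

Definition Kalpha (R : realType) (alpha mu x xi : R) : R[i] :=
  Calpha alpha mu * expi (- ((x ^+ 2 + xi ^+ 2) / 2 * c1 alpha)) *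
  (Num.sqrt (x * xi * c2 alpha) * besselJ mu (x * xi * c2 alpha))%:C.

(* The FrHT of f = g + h in K'_mu, with g a function and h in E'(R_+), is the
   function FrHT_fun g + FrHT_dist h. *)
Definition FrHT_fun (R : realType) (alpha mu : R) (g : R -> R[i])
    (xi : R) : R[i] :=
  cintegral (@Rplus R) (fun x => Kalpha alpha mu x xi * g x).

Definition FrHT_dist (R : realType) (alpha mu : R)
    (h : (R -> R[i]) -> R[i]) (xi : R) : R[i] :=
  h (fun x => Kalpha alpha mu x xi).

Definition Hconst (R : realType) (mu eta : R) : R :=
  Gamma (1 + mu / 2 - eta / 2) / (2 `^ (eta - 1) * Gamma (mu / 2 + eta / 2)).

(* Main.v *)
(* Put v(t) = sqrt(t) J_mu(t), l = xi c2 and G(x) = exp(- i x^2 c1 / 2) g(x). Up to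
   a unimodular factor the transform of g at xi is C_(alpha,mu) int v(l x) G(x) dx.
   As t^(1/2 - eta) v(t) is integrable on (0, oo) (v is bounded, v = O(t^(mu + 1/2))
   at 0, and 3/2 < eta < 2 + mu), the family l (l x)^(1/2 - eta) v(l x) acts as an
   approximate identity at 0 on x^(eta - 1/2) G(x), with total mass Weber's integral
   int t^(1/2 - eta) v(t) dt = H(mu, eta); this gives the limit.

   The distribution h only sees a compact subset of (0, oo). There the kernel may be
   multiplied by a smooth cut-off, and by the Bessel equation all derivatives of v are
   bounded away from 0, so that <h, K> = O(l^r), which is negligible because
   3/2 + r < eta. *)
Require Import Defs.
From HB Require Import structures.
From mathcomp Require Import all_boot all_order all_algebra.
From mathcomp.real_closed Require Import complex.
From mathcomp Require Import all_classical all_reals all_analysis.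
From mathcomp Require Import measurable_realfun ring lra.
Set Implicit Arguments.
Unset Strict Implicit.
Unset Printing Implicit Defensive.
Import Order.TTheory GRing.Theory Num.Theory.
Import numFieldNormedType.Exports.
Local Open Scope classical_set_scope.
Local Open Scope ring_scope.
Local Open Scope complex_scope.

(** * Calculus on (0, oo) *)

(** The Gamma and Bessel functions are available only as Euler's integral and as a power series, so
    whatever is used of them is proved from these. The main obstacle is Weber's integral: the series
    of v cannot be integrated term by term against a power of t over (0, oo). A Gaussian factor
    makes every term integrable, and because the entire factor of v grows no faster than a multiple
    of e^t, the exchange of sum and integral is legitimate for a Gaussian of any width. Boundedness
    of v at infinity is obtained without asymptotic expansions, from an energy that decreases along
    solutions of the Bessel equation when m >= 1/2. The kernel becomes real once its quadratic phase
    is moved onto g, so the analysis is carried out for real functions and applied to real and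
    imaginary parts. *)

Section positive_half_line.
Context {R : realType}.
Local Notation mu := (@lebesgue_measure R).
Implicit Types (x y : R) (F G f : R -> R).

Lemma RplusE x : Rplus x = (0 < x) :> Prop.
Proof. by rewrite /Rplus/= in_itv/= andbT. Qed.

Lemma measurable_Rplus : measurable (@Rplus R).
Proof. exact: measurable_itv. Qed.

Lemma nbhs_gt0 x : 0 < x -> \forall y \near x, 0 < y.
Proof.  exact: lt_nbhsr. Qed.

Lemma near_eq_is_derive_gt0 F G x (d : R) : 0 < x ->
  (forall y, 0 < y -> F y = G y) -> is_derive x 1 F d -> is_derive x 1 G d.
Proof.
move=> x0 FG Fd; apply: near_eq_is_derive Fd.
by near=> y; apply: FG; near: y; exact: nbhs_gt0.
Unshelve. all: by end_near. Qed.

Lemma derive1_gt0E F f x : (forall y, 0 < y -> is_derive y 1 F (f y)) ->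
  0 < x -> derive1 F x = f x.
Proof. by move=> dF x0; rewrite derive1E; have ? := dF _ x0; exact: derive_val. Qed.

Lemma is_derive_ext F x (d d' : R) :
  is_derive x 1 F d -> d = d' -> is_derive x 1 F d'.
Proof. by move=> + <-. Qed.

Lemma is_derive_continuous F x (d : R) : is_derive x 1 F d ->
  {for x, continuous F}.
Proof.
by move=> dF; apply: differentiable_continuous; apply/derivable1_diffP.
Qed.

Lemma near_eq_continuous F G x : 0 < x -> (forall y, 0 < y -> F y = G y) ->
  {for x, continuous F} -> {for x, continuous G}.
Proof.
move=> x0 FG cF; rewrite /prop_for /continuous_at -FG//.
apply: cvg_trans cF; apply: near_eq_cvg.
by near=> y; rewrite FG//; near: y; exact: nbhs_gt0.
Unshelve. all: by end_near. Qed.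

Lemma continuous_fun_comp F G x : {for x, continuous F} ->
  {for F x, continuous G} -> {for x, continuous (fun y => G (F y))}.
Proof. exact: continuous_comp. Qed.

Lemma continuous_Rplus_measurable F :
  (forall x, 0 < x -> {for x, continuous F}) -> measurable_fun (@Rplus R) F.
Proof.
move=> cF; apply: open_continuous_measurable_fun; first exact: interval_open.
by move=> x; rewrite inE /= RplusE; exact: cF.
Qed.

(** Monotone convergence. The endpoints are arbitrary sequences because it is applied both to the
    intervals [1/(n+1), n+1] and to their images under a change of variables. *)
Let exhaust (a b : nat -> R) : (forall n, 0 < a n) ->
  {homo a : m n / (m <= n)%N >-> n <= m} -> {homo b : m n / (m <= n)%N >-> m <= n} ->
  a n @[n --> \oo] --> 0 -> b n @[n --> \oo] --> +oo ->
  forall F, (forall x, 0 < x -> {for x, continuous F}) -> (forall x, 0 < x -> 0 <= F x) ->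
  (\int[mu]_(x in `[a n, b n]) (F x)%:E @[n --> \oo] --> \int[mu]_(x in @Rplus R) (F x)%:E)%E.
Proof.
move=> a0 na nb al bl F cF F0.
have -> : @Rplus R = \bigcup_n `[a n, b n]%classic.
  apply/seteqP; split=> x; rewrite RplusE; last first.
    by move=> [n _]/=; rewrite in_itv/= => /andP[+ _]; exact: lt_le_trans.
  move=> x0.
  near \oo => n; exists n => //=; rewrite in_itv/=; apply/andP; split.
    by near: n; exact: (cvgr_le _ al).
  by near: n; move/cvgryPge : bl; exact.
have sub n : `[a n, b n]%classic `<=` @Rplus R.
  by move=> x /=; rewrite RplusE in_itv/= => /andP[+ _]; exact: lt_le_trans.
apply: ge0_nondecreasing_set_cvg_integral => //.
- move=> m n mn; apply/subsetPset => x /=; rewrite !in_itv/= => /andP[am bm].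
  by rewrite (le_trans _ am) ?na// (le_trans bm) ?nb.
- move=> n; apply/measurable_EFinP; apply: measurable_funS (continuous_Rplus_measurable cF) => //.
  exact: measurable_Rplus.
- by move=> n x /sub; rewrite RplusE lee_fin; exact: F0.
Unshelve. all: by end_near. Qed.

Let inv_dec : {homo (fun n : nat => n.+1%:R^-1 : R) : m n / (m <= n)%N >-> n <= m}.
Proof. by move=> m n mn; rewrite lef_pV2 ?posrE ?ltr0n// ler_nat. Qed.

Let nat_inc : {homo (fun n : nat => n.+1%:R : R) : m n / (m <= n)%N >-> m <= n}.
Proof. by move=> m n mn; rewrite ler_nat. Qed.

Let inv_cvg : (n.+1%:R^-1 : R) @[n --> \oo] --> 0.
Proof. exact: cvg_harmonic. Qed.

Let nat_cvg : (n.+1%:R : R) @[n --> \oo] --> +oo.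
Proof.
by have := @cvgr_idn R; rewrite -(cvg_shiftS (fun n => n%:R : R)).
Qed.

Let inv_cvgr : (n.+1%:R^-1 : R) @[n --> \oo] --> 0^'+.
Proof.
move=> P [e /= e0 He]; have := inv_cvg => /cvgrPdist_lt/(_ e e0).
apply: filterS => n /= Hn; apply: He => //=; by rewrite invr_gt0 ltr0n.
Qed.

Let inv_lt n : (n.+1%:R^-1 : R) <= n.+1%:R.
Proof. by rewrite (@le_trans _ _ 1)// ?invf_le1 ?ltr0n ?ler1n. Qed.

(** The rule on compact intervals passes to the limit on both sides by [exhaust]. The integrals are
    extended reals, so the rule also serves to prove that an integral is finite. *)
Lemma ge0_integration_by_substitution_incr0y F f G :
  (forall x, 0 < x -> 0 < F x) ->
  (forall x y, 0 < x -> x < y -> F x < F y) ->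
  (forall x, 0 < x -> is_derive x 1 F (f x)) ->
  (forall x, 0 < x -> {for x, continuous f}) ->
  F x @[x --> 0^'+] --> 0 -> F x @[x --> +oo] --> +oo ->
  (forall x, 0 < x -> {for x, continuous G}) ->
  (forall x, 0 < x -> 0 <= G x) ->
  (\int[mu]_(x in @Rplus R) (G x)%:E =
   \int[mu]_(x in @Rplus R) (G (F x) * f x)%:E)%E.
Proof.
move=> F0 iF dF cf Fl Fr cG G0.
have lF x y : 0 < x -> x <= y -> F x <= F y.
  by move=> x0; rewrite le_eqVlt => /predU1P[->//|xy]; exact/ltW/iF.
have cF x : 0 < x -> {for x, continuous F}.
  by move=> x0; exact: is_derive_continuous (dF _ x0).
have cF' x : 0 < x -> {for x, continuous (derive1 F)}.
  move=> x0; apply: near_eq_continuous (cf _ x0) => // y y0.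
  by rewrite (derive1_gt0E dF).
have f0 x : 0 < x -> 0 <= f x.
  move=> x0; rewrite -(derive1_gt0E dF)//.
  apply: (@incr_derive1_ge0_itvy _ F false 0).
  - by move=> y; rewrite inE/= in_itv/= andbT => y0; have [] := dF _ y0.
  - by move=> y z; rewrite !in_itv/= !andbT => y0 _; exact: iF.
  - by rewrite in_itv/= x0.
pose a n : R := n.+1%:R^-1; pose b n : R := n.+1%:R.
have a0 n : 0 < a n by rewrite invr_gt0 ltr0n.
have b0 n : 0 < b n by rewrite ltr0n.
have ab n : a n <= b n by exact: inv_lt.
have H1 := @exhaust (F \o a) (F \o b) (fun n => F0 _ (a0 n)) _ _ _ _ G cG G0.
have cGF x : 0 < x -> {for x, continuous (fun x => G (F x) * f x)}.
  move=> x0; apply: cvgM; last exact: cf.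
  by apply: continuous_comp; [exact: cF|exact/cG/F0].
have H2 := @exhaust a b a0 inv_dec nat_inc inv_cvg nat_cvg _ cGF.
apply: cvg_unique (H1 _ _ _ _) _ => //=.
- by move=> m n mn; apply: lF => //; exact: inv_dec.
- by move=> m n mn; apply: lF => //; exact: nat_inc.
- exact: cvg_comp inv_cvgr Fl.
- exact: cvg_comp nat_cvg Fr.
have -> : (fun n => \int[mu]_(x in `[F (a n), F (b n)]) (G x)%:E)%E =
   (fun n => \int[mu]_(x in `[a n, b n]) (G (F x) * f x)%:E)%E.
  apply/funext => n.
  have pos x : a n <= x -> 0 < x by exact: lt_le_trans.
  rewrite (@integration_by_substitution_increasing _ F G (a n) (b n))//.
  - apply: eq_integral => x; rewrite inE /= in_itv/= => /andP[/pos x0 _].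
    by rewrite /GRing.mul/= (derive1_gt0E dF).
  - by move=> x y; rewrite !in_itv/= => /andP[/pos x0 _] _; exact: iF.
  - by move=> x; rewrite in_itv/= => /andP[/ltW/pos x0 _]; exact: cF'.
  - by apply/cvg_ex; eexists; apply: cvg_at_right_filter; exact: cF'.
  - by apply/cvg_ex; eexists; apply: cvg_at_left_filter; exact: cF'.
  - split; first by move=> x; rewrite in_itv/= => /andP[/ltW/pos x0 _]; have [] := dF _ x0.
    + by apply: cvg_at_right_filter; exact: cF.
    + by apply: cvg_at_left_filter; exact: cF.
  - apply: continuous_in_subspaceT => x; rewrite inE/= in_itv/= => /andP[Fx _].
    by apply: cG; apply: lt_le_trans Fx; exact: F0.
by apply: H2 => x x0; rewrite mulr_ge0 ?f0 ?G0 ?F0.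
Qed.

(** The derivative is written [- f] so that the new integrand stays nonnegative; the interval
    [a n, b n] is now mapped onto [F (b n), F (a n)]. *)
Lemma ge0_integration_by_substitution_decr0y F f G :
  (forall x, 0 < x -> 0 < F x) ->
  (forall x y, 0 < x -> x < y -> F y < F x) ->
  (forall x, 0 < x -> is_derive x 1 F (- f x)) ->
  (forall x, 0 < x -> {for x, continuous f}) ->
  F x @[x --> 0^'+] --> +oo -> F x @[x --> +oo] --> 0 ->
  (forall x, 0 < x -> {for x, continuous G}) ->
  (forall x, 0 < x -> 0 <= G x) ->
  (\int[mu]_(x in @Rplus R) (G x)%:E =
   \int[mu]_(x in @Rplus R) (G (F x) * f x)%:E)%E.
Proof.
move=> F0 iF dF cf Fl Fr cG G0.
have lF x y : 0 < x -> x <= y -> F y <= F x.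
  by move=> x0; rewrite le_eqVlt => /predU1P[->//|xy]; exact/ltW/iF.
have cF x : 0 < x -> {for x, continuous F}.
  by move=> x0; exact: is_derive_continuous (dF _ x0).
have cF' x : 0 < x -> {for x, continuous (derive1 F)}.
  move=> x0; apply: near_eq_continuous (cvgN (cf _ x0)) => // y y0.
  by rewrite (derive1_gt0E dF).
have f0 x : 0 < x -> 0 <= f x.
  move=> x0; rewrite -oppr_le0 -(derive1_gt0E dF)//.
  apply: (@decr_derive1_le0_itvy _ F false 0).
  - by move=> y; rewrite inE/= in_itv/= andbT => y0; have [] := dF _ y0.
  - by move=> y z; rewrite !in_itv/= !andbT => _ z0; exact: iF.
  - by rewrite in_itv/= x0.
pose a n : R := n.+1%:R^-1; pose b n : R := n.+1%:R.
have a0 n : 0 < a n by rewrite invr_gt0 ltr0n.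
have b0 n : 0 < b n by rewrite ltr0n.
have ab n : a n <= b n by exact: inv_lt.
have H1 := @exhaust (F \o b) (F \o a) (fun n => F0 _ (b0 n)) _ _ _ _ G cG G0.
have cGF x : 0 < x -> {for x, continuous (fun x => G (F x) * f x)}.
  move=> x0; apply: cvgM; last exact: cf.
  by apply: continuous_comp; [exact: cF|exact/cG/F0].
have H2 := @exhaust a b a0 inv_dec nat_inc inv_cvg nat_cvg _ cGF.
apply: cvg_unique (H1 _ _ _ _) _ => //=.
- by move=> m n mn; apply: lF => //; exact: nat_inc.
- by move=> m n mn; apply: lF => //; exact: inv_dec.
- exact: cvg_comp nat_cvg Fr.
- exact: cvg_comp inv_cvgr Fl.
have -> : (fun n => \int[mu]_(x in `[F (b n), F (a n)]) (G x)%:E)%E =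
   (fun n => \int[mu]_(x in `[a n, b n]) (G (F x) * f x)%:E)%E.
  apply/funext => n.
  have pos x : a n <= x -> 0 < x by exact: lt_le_trans.
  rewrite (@integration_by_substitution_decreasing _ F G (a n) (b n))//.
  - apply: eq_integral => x; rewrite inE /= in_itv/= => /andP[/pos x0 _].
    by rewrite [in LHS]/GRing.mul/= /GRing.opp/= (derive1_gt0E dF)// opprK.
  - by move=> x y; rewrite !in_itv/= => _ /andP[/pos y0 _]; exact: iF.
  - by move=> x; rewrite in_itv/= => /andP[/ltW/pos x0 _]; exact: cF'.
  - by apply/cvg_ex; eexists; apply: cvg_at_right_filter; exact: cF'.
  - by apply/cvg_ex; eexists; apply: cvg_at_left_filter; exact: cF'.
  - split; first by move=> x; rewrite in_itv/= => /andP[/ltW/pos x0 _]; have [] := dF _ x0.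
    + by apply: cvg_at_right_filter; exact: cF.
    + by apply: cvg_at_left_filter; exact: cF.
  - apply: continuous_in_subspaceT => x; rewrite inE/= in_itv/= => /andP[Fx _].
    by apply: cG; apply: lt_le_trans Fx; exact: F0.
by apply: H2 => x x0; rewrite mulr_ge0 ?f0 ?G0 ?F0.
Qed.

End positive_half_line.
#[global] Hint Extern 0 (measurable _) => solve [exact: measurable_Rplus] : core.

(** * The Gamma function *)

Section euler_gamma.
Context {R : realType}.
Local Notation mu := (@lebesgue_measure R).
Implicit Types (x y s t c p : R) (F G f : R -> R).

Lemma le_integrable_EFin (A : set R) f G : measurable A ->
  measurable_fun A f -> mu.-integrable A (EFin \o G) ->
  (forall x, A x -> `|f x| <= G x) -> mu.-integrable A (EFin \o f).
Proof.
move=> mA mf iG fG; apply: le_integrable iG => //; first exact/measurable_EFinP.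
by move=> x Ax; rewrite /= lee_fin (le_trans (fG _ Ax))// ler_norm.
Qed.

Lemma integrableZl_EFin (A : set R) c f : measurable A ->
  mu.-integrable A (EFin \o f) -> mu.-integrable A (EFin \o (fun x => c * f x)).
Proof.
move=> mA fi.
by apply: (@eq_integrable _ _ _ mu A mA (fun x => (c%:E * (EFin \o f) x)%E)) => //; exact: integrableZl.
Qed.

Lemma continuous_powR p x : 0 < x -> {for x, continuous (fun y => y `^ p)}.
Proof. by move=> x0; exact: is_derive_continuous (is_derive1_powR p x0). Qed.

Lemma is_derive_expRM c x : is_derive x 1 (fun y => expR (c * y)) (c * expR (c * x)).
Proof.
have H : is_derive x 1 (fun y => c * y) c.
  by have := is_deriveZ c (is_derive_id x (1 : R)); rewrite /GRing.scale/= mulr1.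
by rewrite mulrC; exact: (is_derive1_comp (is_derive_expR (c * x)) H).
Qed.

Lemma continuous_expRM c x : {for x, continuous (fun y => expR (c * y))}.
Proof. exact: is_derive_continuous (is_derive_expRM c x). Qed.

(** Apply ln u <= u - 1 at u = c x / p. This gives the constant (p / c)^p, after a factor e^(-p) is
    dropped. *)
Lemma powR_le_expR p c : 0 <= p -> 0 < c ->
  exists2 C : R, 0 < C & forall x, 0 < x -> x `^ p <= C * expR (c * x).
Proof.
rewrite le_eqVlt => /predU1P[<- c0|p0 c0].
  exists 1 => // x x0; rewrite powRr0 mul1r -expR0 ler_expR.
  by rewrite mulr_ge0// ltW.
exists (expR (p * ln (p / c))); first exact: expR_gt0.
move=> x x0; rewrite /powR gt_eqF// -expRD ler_expR.
have y0 : 0 < c * x / p by rewrite divr_gt0// mulr_gt0.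
have -> : ln x = ln (c * x / p) + ln (p / c).
  rewrite -lnM ?posrE ?divr_gt0 ?mulr_gt0//.
  suff e : x = c * x / p * (p / c) by rewrite {1}e.
  by field; rewrite !gt_eqF.
rewrite mulrDr addrC lerD2l.
have h : ln (c * x / p) <= c * x / p - 1.
  by rewrite -{1}[c * x / p](subrKC 1) le_ln1Dx// ltrBrDl subrr.
apply: (le_trans (ler_wpM2l (ltW p0) h)).
rewrite mulrBr mulr1 mulrC divfK ?gt_eqF//; lra.
Qed.

Lemma cvg_expRN c : 0 < c -> expR (- c * x) @[x --> +oo] --> 0.
Proof.
move=> c0; under eq_fun do rewrite mulNr.
apply: (@cvg_comp _ _ _ (fun x => c * x) (fun x => expR (- x)) _ _ _ _ (@cvgr_expR R)).
exact: gt0_cvgMry.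
Qed.

Lemma integral_expRN c : 0 < c ->
  (\int[mu]_(x in @Rplus R) (expR (- c * x))%:E = c^-1%:E)%E.
Proof.
move=> c0; rewrite /Rplus integral_itv_obnd_cbnd; last first.
  apply/measurable_EFinP; apply: continuous_Rplus_measurable => x _.
  exact: continuous_expRM.
have dF x : is_derive x 1 (fun y => - c^-1 * expR (- c * y)) (expR (- c * x)).
  have ? := is_derive_expRM (- c) x.
  apply: is_derive_eq.
  by rewrite /GRing.scale/=; field; rewrite gt_eqF.
rewrite (@ge0_continuous_FTC2y _ _ (fun y => - c^-1 * expR (- c * y)) _ 0) //.
- by rewrite mulr0 expR0 mulr1 sub0e -EFinN opprK.
- by apply: continuous_subspaceT => x; exact: continuous_expRM.
- by rewrite -(mulr0 (- c^-1)); apply: cvgM; [exact: cvg_cst|exact: cvg_expRN].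
- by apply: cvg_at_right_filter; exact: is_derive_continuous (dF 0).
- by move=> x _; rewrite derive1E; exact: derive_val.
Qed.

Lemma integrable_expRN c : 0 < c ->
  mu.-integrable (@Rplus R) (EFin \o (fun x => expR (- c * x))).
Proof.
move=> c0; apply/integrableP; split.
  apply/measurable_EFinP; apply: continuous_Rplus_measurable => x _.
  exact: continuous_expRM.
under eq_integral do rewrite /= ger0_norm ?expR_ge0//.
by rewrite integral_expRN// ltry.
Qed.

Definition gamma_integrand s t := t `^ (s - 1) * expR (- t).

Lemma continuous_gamma_integrand s x : 0 < x ->
  {for x, continuous (gamma_integrand s)}.
Proof.
move=> x0; apply: cvgM; first exact: continuous_powR.
apply: near_eq_continuous (@continuous_expRM (- 1) x) => // y _.
by rewrite mulN1r.
Qed.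

Lemma gamma_integrand_ge0 s x : 0 <= gamma_integrand s x.
Proof. by rewrite mulr_ge0 ?powR_ge0 ?expR_ge0. Qed.

Lemma measurable_gamma_integrand s : measurable_fun (@Rplus R) (gamma_integrand s).
Proof. by apply: continuous_Rplus_measurable => x; exact: continuous_gamma_integrand. Qed.

Lemma powR_cvgy p : 0 < p -> x `^ p @[x --> +oo] --> +oo.
Proof.
move=> p0; apply/cvgryPge => A.
near=> x; rewrite (@le_trans _ _ ((Num.max A 1) `^ (p^-1) `^ p))//.
  by rewrite -powRrM mulVf ?gt_eqF// powRr1 ?le_max ?lexx// ler01 orbT.
have xM : Num.max A 1 `^ p^-1 <= x by near: x; exact: nbhs_pinfty_ge.
apply: ge0_ler_powR; rewrite ?nnegrE ?powR_ge0 ?(ltW p0)//.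
Unshelve. all: by end_near. Qed.

(** For s < 1 the substitution t = u^(1/s) removes the singularity at 0 and leaves exp(- u^(1/s)) /
    s, which is at most e e^(-u) / s; the factor e takes care of u <= 1. For s >= 1 the power is
    absorbed by half of the exponential. *)
Lemma integrable_gamma s : 0 < s ->
  mu.-integrable (@Rplus R) (EFin \o gamma_integrand s).
Proof.
move=> s0; have [s1|s1] := ltP s 1.
  apply/integrableP; split.
    by apply/measurable_EFinP; exact: measurable_gamma_integrand.
  under eq_integral do rewrite /= ger0_norm ?gamma_integrand_ge0//.
  pose f u := s^-1 * u `^ (s^-1 - 1).
  have si : 1 <= s^-1 by rewrite invf_ge1 ?ltW.
  rewrite (@ge0_integration_by_substitution_incr0y _ (fun u => u `^ s^-1) f).
  - apply: (@le_lt_trans _ _ (\int[mu]_(x in @Rplus R) (s^-1 * expR 1 * expR (- 1 * x))%:E)%E).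
      apply: ge0_le_integral => //=.
      + by move=> x x0; rewrite lee_fin mulr_ge0 ?gamma_integrand_ge0 ?mulr_ge0 ?invr_ge0 ?powR_ge0// ltW.
      + apply/measurable_EFinP; apply: continuous_Rplus_measurable => x x0.
        apply: cvgM; last by apply: cvgM; [exact: cvg_cst|exact: continuous_powR].
        apply: (@continuous_fun_comp _ (fun y => y `^ s^-1)); first exact: continuous_powR.
        by apply: continuous_gamma_integrand; exact: powR_gt0.
      + apply/measurable_EFinP; apply: measurable_funM => //.
        by apply: continuous_Rplus_measurable => x x0; exact: continuous_expRM.
      + move=> x; rewrite RplusE lee_fin => x0; rewrite /gamma_integrand /f -powRrM.
        rewrite mulrCA -mulrA ler_pM2l ?invr_gt0// mulrAC -powRD; last first.
          by rewrite (@gt_eqF _ _ x)//; exact: implybT.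
        have -> : s^-1 * (s - 1) + (s^-1 - 1) = 0 by field; rewrite gt_eqF.
        rewrite powRr0 mul1r -expRD ler_expR mulN1r.
        have [x1|x1] := leP x 1; first by have := powR_ge0 x s^-1; lra.
        by have := le1r_powR (ltW x1) si; lra.
    under eq_integral do rewrite EFinM.
    rewrite ge0_integralZl//=.
    + by rewrite integral_expRN// -EFinM ltry.
    + apply/measurable_EFinP.
      by apply: continuous_Rplus_measurable => x x0; exact: continuous_expRM.
    + by rewrite lee_fin mulr_ge0 ?expR_ge0 ?invr_ge0// ltW.
  - by move=> x x0; exact: powR_gt0.
  - by move=> x y x0 xy; rewrite gt0_ltr_powR ?invr_gt0// nnegrE ltW// (lt_trans x0).
  - by move=> x x0; apply: cvgM; [exact: cvg_cst|exact: continuous_powR].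
  - by apply: powR_cvg0; rewrite invr_gt0.
  - by apply: powR_cvgy; rewrite invr_gt0.
  - by move=> x x0; exact: continuous_gamma_integrand.
  - by move=> x x0; exact: gamma_integrand_ge0.
have s1' : 0 <= s - 1 by lra.
have h2 : 0 < 2^-1 :> R by lra.
have [C C0 HC] := powR_le_expR s1' h2.
apply: (@le_integrable_EFin _ _ (fun x => C * expR (- 2^-1 * x))).
- exact: measurable_Rplus.
- exact: measurable_gamma_integrand.
- by apply: integrableZl_EFin => //; exact: integrable_expRN.
move=> x; rewrite RplusE => x0; rewrite ger0_norm ?gamma_integrand_ge0//.
rewrite /gamma_integrand.
apply: (le_trans (ler_wpM2r (expR_ge0 _) (HC _ x0))).
by rewrite -mulrA -expRD ler_pM2l// ler_expR; lra.
Qed.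

Lemma Gamma_gt0 s : 0 < s -> 0 < Gamma s.
Proof.
(* On [1, 2] one has t^(s - 1) >= 1/t >= 1/2 for every s > 0, and e^(-t) >= e^(-2). *)
move=> s0; pose m : R := 2^-1 * expR (- 2).
have m0 : 0 < m by rewrite mulr_gt0 ?expR_gt0 ?invr_gt0.
have sub : `[1, 2]%classic `<=` @Rplus R.
  by move=> x /=; rewrite RplusE in_itv/= => /andP[+ _]; exact: lt_le_trans.
have := integrable_gamma s0; move=> /integrableP[_ fin].
rewrite /Gamma /Rintegral fine_gt0//; apply/andP; split; last first.
  by under eq_integral do rewrite /= -[_%:E]gee0_abs ?lee_fin ?gamma_integrand_ge0//.
apply: (@lt_le_trans _ _ (\int[mu]_(x in `[1%R, 2%R]) m%:E)%E).
  rewrite integral_cst//= lebesgue_measure_itv/= lte_fin ifT; last lra.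
  by rewrite -EFinB -EFinM lte_fin mulr_gt0//; lra.
apply: (@le_trans _ _ (\int[mu]_(x in `[1%R, 2%R]) (gamma_integrand s x)%:E)%E).
  apply: ge0_le_integral => //=.
  - by move=> x _; rewrite lee_fin ltW.
  - apply/measurable_EFinP; apply: measurable_funS sub (measurable_gamma_integrand s).
    exact: measurable_Rplus.
  - move=> x; rewrite in_itv/= lee_fin => /andP[x1 x2].
    apply: ler_pM; rewrite ?expR_ge0 ?invr_ge0// ?ler_expR; last lra.
    apply: (@le_trans _ _ (x `^ (- 1))); last by apply: ler_powR => //; lra.
    by rewrite powR_inv1 ?lef_pV2 ?posrE//; lra.
apply: ge0_subset_integral => //.
- by apply/measurable_EFinP; exact: measurable_gamma_integrand.
- by move=> x _; rewrite lee_fin gamma_integrand_ge0.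
Qed.

(** Integration by parts, through a fundamental theorem of calculus for nonnegative integrands. The
    derivative of t^s e^(-t) changes sign, so C e^(-t/2) is added to make it nonnegative; its
    integral 2 C equals - F(0) and cancels at the end. The hypothesis 1 < s makes t^(s - 1)
    continuous at 0 with value 0. *)
Lemma GammaS s : 1 < s -> Gamma (s + 1) = s * Gamma s.
Proof.
move=> s1; have s0 : 0 < s by lra.
have [||C C0 HC] := @powR_le_expR s (2^-1) _ _; [lra|lra|].
have HC' x : 0 <= x -> x `^ s * expR (- x) <= C * expR (- 2^-1 * x).
  rewrite le_eqVlt => /predU1P[<-|x0].
    by rewrite powR0 ?gt_eqF// mul0r mulr_ge0 ?expR_ge0// ltW.
  apply: (le_trans (ler_wpM2r (expR_ge0 _) (HC _ x0))).
  by rewrite -mulrA -expRD ler_pM2l// ler_expR; lra.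
pose f x := s * gamma_integrand s x - gamma_integrand (s + 1) x + C * expR (- 2^-1 * x).
pose F x := x `^ s * expR (- x) - 2 * C * expR (- 2^-1 * x).
have dF x : 0 < x -> is_derive x 1 F (f x).
  move=> x0; have ? := is_derive1_powR s x0.
  have ? := is_derive_expRM (- 2^-1) x.
  apply: is_derive_eq.
  rewrite /f /gamma_integrand addrK /GRing.scale/=.
  by field.
have cont0 p : 0 < p -> x `^ p @[x --> 0^'+] --> 0 `^ p.
  by move=> p0; rewrite powR0 ?gt_eqF//; exact: powR_cvg0.
have cexp c : expR (c * x) @[x --> 0^'+] --> expR (c * 0).
  by apply: cvg_at_right_filter; exact: continuous_expRM.
have cexpN : expR (- x) @[x --> 0^'+] --> expR (- 0 : R).
  have := cexp (- 1); rewrite mulN1r; under eq_fun do rewrite mulN1r; exact.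
have cf0 : f x @[x --> 0^'+] --> f 0.
  apply: cvgD; last by apply: cvgM; [exact: cvg_cst|exact: cexp].
  apply: cvgB.
    apply: cvgM; first exact: cvg_cst.
    by apply: cvgM => //; apply: cont0; lra.
  by apply: cvgM => //; apply: cont0; lra.
have cF0 : F x @[x --> 0^'+] --> F 0.
  apply: cvgB; last by apply: cvgM; [exact: cvg_cst|exact: cexp].
  by apply: cvgM => //; exact: cont0.
have cF : F x @[x --> +oo] --> 0.
  rewrite -[X in _ --> X]subr0 -[X in _ - X](mulr0 (2 * C)); apply: cvgB; last first.
    by apply: cvgM; [exact: cvg_cst|apply: cvg_expRN; lra].
  apply: (@squeeze_cvgr _ _ _ _ (cst 0) (fun x => C * expR (- 2^-1 * x))).
  - near=> y; rewrite HC' ?mulr_ge0 ?powR_ge0 ?expR_ge0//.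
  - exact: cvg_cst.
  - by rewrite -(mulr0 C); apply: cvgM; [exact: cvg_cst|apply: cvg_expRN; lra].
have f0 x : 0 <= x -> 0 <= f x.
  move=> x0; rewrite /f; have := HC' _ x0; have := gamma_integrand_ge0 s x.
  rewrite /gamma_integrand addrK => g0; have := mulr_ge0 (ltW s0) g0; lra.
have If : \int[mu]_(x in @Rplus R) f x = 2 * C.
  have cfx x : 0 < x -> {for x, continuous f}.
    move=> x0; apply: cvgD; last by apply: cvgM; [exact: cvg_cst|exact: continuous_expRM].
    apply: cvgB; last exact: continuous_gamma_integrand.
    by apply: cvgM; [exact: cvg_cst|exact: continuous_gamma_integrand].
  rewrite /Rintegral integral_itv_obnd_cbnd; last first.
    by apply/measurable_EFinP; exact: continuous_Rplus_measurable.
  have -> : (\int[mu]_(x in `[0%R, +oo[) (f x)%:E = 0%:E - (F 0)%:E)%E.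
    apply: ge0_continuous_FTC2y.
    - exact: f0.
    - apply/continuous_within_itvcyP; split; last exact: cf0.
      by move=> x; rewrite in_itv/= andbT; exact: cfx.
    - exact: cF.
    - by move=> x x0; have [] := dF _ x0.
    - exact: cF0.
    - by move=> x; rewrite in_itv/= andbT => x0; rewrite (derive1_gt0E dF).
  by rewrite /= /F powR0 ?gt_eqF// mulr0 expR0; ring.
have i1 : mu.-integrable (@Rplus R) (EFin \o (fun x => s * gamma_integrand s x)).
  by apply: integrableZl_EFin => //; exact: integrable_gamma.
have i2 : mu.-integrable (@Rplus R) (EFin \o gamma_integrand (s + 1)).
  by apply: integrable_gamma; lra.
have i3 : mu.-integrable (@Rplus R) (EFin \o (fun x => C * expR (- 2^-1 * x))).
  by apply: integrableZl_EFin => //; apply: integrable_expRN; lra.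
move: If; rewrite RintegralD//=; last first.
  exact: (@integrableB _ _ _ mu _ measurable_Rplus _ _ i1 i2).
rewrite RintegralB//.
rewrite RintegralZl//; last exact: integrable_gamma.
rewrite RintegralZl//; last by apply: integrable_expRN; lra.
rewrite {3}/Rintegral integral_expRN; last lra.
rewrite /= invrK -/(Gamma _) -/(Gamma _); lra.
Unshelve. all: by end_near. Qed.

Lemma integral_gamma s : 0 < s ->
  (\int[mu]_(x in @Rplus R) (gamma_integrand s x)%:E = (Gamma s)%:E)%E.
Proof.
move=> s0; rewrite /Gamma /Rintegral fineK//.
by apply: integrable_fin_num => //; exact: integrable_gamma.
Qed.

Lemma integralZ_gamma s c : 0 < s -> 0 <= c ->
  (\int[mu]_(x in @Rplus R) (c * gamma_integrand s x)%:E = (c * Gamma s)%:E)%E.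
Proof.
move=> s0 c0; under eq_integral do rewrite EFinM.
rewrite ge0_integralZl//.
- by rewrite integral_gamma.
- by apply/measurable_EFinP; exact: measurable_gamma_integrand.
- by move=> x _; exact: gamma_integrand_ge0.
Qed.

Lemma continuousZ_gamma s c x : 0 < x ->
  {for x, continuous (fun t => c * gamma_integrand s t)}.
Proof.
by move=> x0; apply: cvgM; [exact: cvg_cst|exact: continuous_gamma_integrand].
Qed.

Lemma powR_expR p x : 0 < x -> x `^ p = expR (p * ln x).
Proof. by move=> x0; rewrite /powR gt_eqF. Qed.

(** Substitute u = y t^2 in Euler's integral. *)
Lemma integral_gaussian_moment s y : 0 < s -> 0 < y ->
  (\int[mu]_(t in @Rplus R) (t `^ (2 * s - 1) * expR (- y * t ^+ 2))%:E =
   (y `^ (- s) / 2 * Gamma s)%:E)%E.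
Proof.
move=> s0 y0; have k0 : 0 <= y `^ (- s) / 2 by rewrite divr_ge0 ?powR_ge0.
have sq0 x : 0 < x -> 0 < y * x ^+ 2 by move=> x0; rewrite mulr_gt0// exprn_gt0.
rewrite -(integralZ_gamma s0 k0).
have dF x : 0 < x -> is_derive x 1 (fun t => y * t ^+ 2) (y * (2 * x)).
  move=> x0; apply: is_derive_eq.
  by rewrite /GRing.scale/=; ring.
have iF u v : 0 < u -> u < v -> y * u ^+ 2 < y * v ^+ 2.
  by move=> u0 uv; rewrite ltr_pM2l// ltr_pXn2r// ?nnegrE ltW// (lt_trans u0).
rewrite [RHS](@ge0_integration_by_substitution_incr0y _ _ _ _ sq0 iF dF).
- apply: eq_integral => x; rewrite inE RplusE => x0; congr EFin.
  rewrite /gamma_integrand mulNr powRM ?(ltW y0)// ?sqr_ge0//.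
  rewrite -(@powR_mulrn _ x 2) ?(ltW x0)// -powRrM.
  rewrite (_ : y `^ (- s) / 2 * (y `^ (s - 1) * x `^ (2 * (s - 1)) *
      expR (- (y * x `^ 2))) * (y * (2 * x)) =
    y `^ (- s) * y `^ (s - 1) * y * (x `^ (2 * (s - 1)) * x) * expR (- (y * x `^ 2))); last by field.
  rewrite -powRD; last by rewrite (gt_eqF y0) implybT.
  rewrite (_ : - s + (s - 1) = - 1); last by ring.
  rewrite powR_inv1 ?(ltW y0)// mulVf ?gt_eqF// mul1r.
  congr (_ * _); rewrite -{3}(powRr1 (ltW x0)) -powRD ?(gt_eqF x0) ?implybT//.
  by congr (_ `^ _); ring.
- move=> x x0; apply: cvgM; first exact: cvg_cst.
  by apply: cvgM; first exact: cvg_cst.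
- rewrite -[X in _ --> X](mulr0 y); apply: cvgM; first exact: cvg_cst.
  rewrite -[X in _ --> X](expr0n R 2); apply: cvg_at_right_filter.
  exact: exprn_continuous.
- by apply: gt0_cvgMry => //; exact: cvgr_expr2.
- by move=> x; exact: continuousZ_gamma.
- by move=> x _; rewrite mulr_ge0// gamma_integrand_ge0.
Qed.

(** Read from right to left, this writes c^(-s) as a superposition of exponentials e^(- c y);
    [weber_integral] uses it with c = t^2. *)
Lemma integral_gamma_scale s c : 0 < s -> 0 < c ->
  (\int[mu]_(y in @Rplus R) (y `^ (s - 1) * expR (- y * c))%:E =
   (c `^ (- s) * Gamma s)%:E)%E.
Proof.
move=> s0 c0; rewrite -(integralZ_gamma s0 (powR_ge0 _ _)).
have F0 x : 0 < x -> 0 < c * x by move=> x0; rewrite mulr_gt0.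
have iF u v : 0 < u -> u < v -> c * u < c * v by move=> u0 uv; rewrite ltr_pM2l.
have dF x : 0 < x -> is_derive x 1 (fun t => c * t) (cst c x).
  by move=> x0; have := is_deriveZ c (is_derive_id x (1 : R)); rewrite /GRing.scale/= mulr1.
rewrite [RHS](@ge0_integration_by_substitution_incr0y _ _ _ _ F0 iF dF).
- apply: eq_integral => x; rewrite inE RplusE => x0; congr EFin.
  rewrite /gamma_integrand powRM ?(ltW c0) ?(ltW x0)//=.
  rewrite (_ : c `^ (- s) * _ * _ = c `^ (- s) * c `^ (s - 1) * c *
    (x `^ (s - 1) * expR (- (c * x)))); last by ring.
  rewrite -powRD; last by rewrite (gt_eqF c0) implybT.
  rewrite (_ : - s + (s - 1) = - 1); last by ring.
  by rewrite powR_inv1 ?(ltW c0)// mulVf ?gt_eqF// mul1r mulNr [x * c]mulrC.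
- by move=> x x0; exact: cvg_cst.
- rewrite -[X in _ --> X](mulr0 c); apply: cvgM; first exact: cvg_cst.
  exact: cvg_at_right_filter.
- exact: gt0_cvgMry.
- by move=> x; exact: continuousZ_gamma.
- by move=> x _; rewrite mulr_ge0 ?powR_ge0// gamma_integrand_ge0.
Qed.

(** The decreasing substitution u = 1 / (4 y) in Euler's integral. *)
Lemma integral_gamma_inv s : 0 < s ->
  (\int[mu]_(y in @Rplus R) (y `^ (- s - 1) * expR (- (4 * y)^-1))%:E =
   (4 `^ s * Gamma s)%:E)%E.
Proof.
move=> s0; rewrite -(integralZ_gamma s0 (powR_ge0 _ _)).
have inv0 x : 0 < x -> 0 < (4 * x)^-1 by move=> x0; rewrite invr_gt0 mulr_gt0.
have iF u v : 0 < u -> u < v -> (4 * v)^-1 < (4 * u)^-1 :> R.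
  by move=> u0 uv; rewrite ltf_pV2 ?posrE ?mulr_gt0 ?ltr_pM2l// (lt_trans u0).
have dF x : 0 < x -> is_derive x 1 (fun t => (4 * t)^-1) (- (4 * x ^+ 2)^-1).
  move=> x0.
  have d : is_derive x 1 (fun y => 4 * y) 4.
    by have := is_deriveZ (4 : R) (is_derive_id x (1 : R)); rewrite /GRing.scale/= mulr1.
  have x40 : 4 * x != 0 by rewrite mulf_neq0// gt_eqF.
  have dV := @is_deriveV _ (fun y => 4 * y) x 4 1 x40 d.
  apply: is_derive_eq.
  by rewrite /GRing.scale/=; field; rewrite gt_eqF.
rewrite [RHS](@ge0_integration_by_substitution_decr0y _ _ _ _ inv0 iF dF).
- apply: eq_integral => x; rewrite inE RplusE => x0; congr EFin.
  have x40 : 0 <= 4 * x by lra.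
  rewrite /gamma_integrand -[in RHS](powR_inv1 x40) -powRrM powRM ?(ltW x0)//.
  rewrite (_ : (4 * x ^+ 2)^-1 = 4 `^ (-1) * x `^ (- 2)); last first.
    by rewrite powR_inv1// powR_invn ?(ltW x0)// invfM.
  rewrite (_ : 4 `^ s * _ * _ = (4 `^ s * 4 `^ (- 1 * (s - 1)) * 4 `^ (-1)) *
    (x `^ (- 1 * (s - 1)) * x `^ (- 2)) * expR (- (4 * x) `^ (-1))); last by ring.
  have -> : 4 `^ s * 4 `^ (- 1 * (s - 1)) * 4 `^ (-1) = 1 :> R.
    rewrite !powR_expR// -!expRD (_ : _ + _ = 0) ?expR0//; ring.
  rewrite mul1r powR_inv1// -powRD ?(gt_eqF x0) ?implybT//; congr (_ `^ _ * _).
  by ring.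
- move=> x x0; apply: cvgV; first by rewrite mulf_neq0 ?gt_eqF// exprn_gt0.
  by apply: cvgM; [exact: cvg_cst|exact: exprn_continuous].
- apply/cvgrVy.
    by near=> x; rewrite mulr_gt0//; near: x; exact: nbhs_right_gt.
  rewrite -[X in _ --> X](mulr0 4); apply: cvgM; first exact: cvg_cst.
  exact: cvg_at_right_filter.
- apply/gtr0_cvgV0.
    by near=> x; rewrite mulr_gt0//; near: x; exact: nbhs_pinfty_gt.
  exact: gt0_cvgMry.
- by move=> x; exact: continuousZ_gamma.
- by move=> x _; rewrite mulr_ge0 ?powR_ge0// gamma_integrand_ge0.
Unshelve. all: by end_near. Qed.

End euler_gamma.

(** * Bessel functions *)

Section bessel_series.
Context {R : realType}.
Implicit Types (m x t z : R) (k n : nat).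

(* J_m(t) = (t/2)^m E_m(t^2/4), where E_m has the coefficients [bessel_coef m]
   and satisfies E_m' = - E_(m+1). *)
Definition bessel_coef m k : R := (-1) ^+ k / (k`!%:R * Gamma (k%:R + m + 1)).

(** The functional equation of Gamma at k + m + 1; the assumption 0 < m puts this argument above 1
    even for k = 0, as [GammaS] demands. *)
Lemma bessel_coefS_order m k : 0 < m ->
  bessel_coef m k = (k%:R + m + 1) * bessel_coef (m + 1) k.
Proof.
move=> m0; have k0 : 0 <= k%:R :> R by exact: ler0n.
have g0 : Gamma (k%:R + m + 1) != 0 :> R by rewrite gt_eqF// Gamma_gt0//; lra.
have f0 : k`!%:R != 0 :> R by rewrite pnatr_eq0 -lt0n fact_gt0.
rewrite /bessel_coef addrA (@GammaS _ (k%:R + m + 1)); last by lra.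
by field; rewrite f0 g0 !andbT; lra.
Qed.

(** E_m' = - E_(m+1) on coefficients. The Gamma factors on the two sides have the same argument, so
    only (k+1)! = (k+1) k! and a sign are involved. *)
Lemma pseries_diffs_bessel_coef m : 0 < m ->
  pseries_diffs (bessel_coef m) = (fun k => - bessel_coef (m + 1) k).
Proof.
move=> m0; apply/funext => k; rewrite /pseries_diffs /bessel_coef.
have k0 : 0 <= k%:R :> R by exact: ler0n.
have -> : k.+1%:R + m + 1 = k%:R + (m + 1) + 1 by rewrite -natr1; ring.
have g0 : Gamma (k%:R + (m + 1) + 1) != 0 :> R by rewrite gt_eqF// Gamma_gt0//; lra.
have f0 : k`!%:R != 0 :> R by rewrite pnatr_eq0 -lt0n fact_gt0.
rewrite factS natrM exprS -natr1; field.
by rewrite f0 g0; lra.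
Qed.

Lemma bessel_coef_step m k : 0 < m ->
  bessel_coef m k.+1 = - bessel_coef m k / (k.+1%:R * (k%:R + m + 1)).
Proof.
move=> m0; have k0 : 0 <= k%:R :> R by exact: ler0n.
have /(congr1 (fun f => f k)) := pseries_diffs_bessel_coef m0.
rewrite /pseries_diffs (bessel_coefS_order k m0) => h.
apply: (@mulfI _ k.+1%:R); first by rewrite pnatr_eq0.
by rewrite h -natr1; field; rewrite andbC; apply/andP; split; lra.
Qed.

Lemma bessel_coef0_gt0 m : 0 < m -> 0 < bessel_coef m 0.
Proof.
move=> m0; rewrite /bessel_coef expr0 fact0 mul1r mul1r add0r invr_gt0.
by apply: Gamma_gt0; lra.
Qed.

(** Passing from k to k+1 divides by (k+1)(k+m+1) >= (k+1)^2. Keeping both factorials matters: they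
    give growth e^t below, where a single one would give e^(t^2/4), too much for a narrow range of
    Gaussians exp(- y t^2) with small y. *)
Lemma norm_bessel_coef_le m k : 0 < m ->
  `|bessel_coef m k| <= bessel_coef m 0 * (k`!%:R^-1) ^+ 2.
Proof.
move=> m0; have b0 := bessel_coef0_gt0 m0.
elim: k => [|k IH]; first by rewrite fact0 invr1 expr1n mulr1 ger0_norm// ltW.
have k0 : 0 <= k%:R :> R by exact: ler0n.
rewrite bessel_coef_step// normrM normrN normfV.
rewrite (ger0_norm (_ : 0 <= k.+1%:R * _)); last by rewrite mulr_ge0//; lra.
rewrite ler_pdivrMr; last by rewrite mulr_gt0// ?ltr0n//; lra.
apply: (le_trans IH); rewrite factS natrM invfM exprMn -[leRHS]mulrA ler_pM2l//.
rewrite mulrAC -[leLHS]mul1r ler_wpM2r ?sqr_ge0//.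
rewrite mulrC exprVn ler_pdivlMr ?exprn_gt0 ?ltr0n// mul1r expr2.
by rewrite ler_wpM2l// -natr1; lra.
Qed.

(** The k-th term is at most a constant times a_k^2, where a_k = (t/2)^k / k!. One factor a_k is
    bounded by e^(t/2), and the other sums to at most e^(t/2). *)
Lemma sum_norm_bessel_le m t n : 0 < m -> 0 <= t ->
  \sum_(0 <= k < n) `|bessel_coef m k| * (t ^+ 2 / 4) ^+ k <=
  bessel_coef m 0 * expR t.
Proof.
move=> m0 t0; have b0 := bessel_coef0_gt0 m0.
pose a k := exp_coeff (t / 2) k.
have t20 : 0 <= t / 2 by rewrite divr_ge0.
have a0 k : 0 <= a k by exact: exp_coeff_ge0.
have le_exp j : \sum_(0 <= k < j) a k <= expR (t / 2).
  apply: (@nondecreasing_cvgn_le _ (series a)); last exact: is_cvg_series_exp_coeff.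
  by apply/nondecreasing_seqP => k; rewrite /series/= big_nat_recr//= lerDl.
have a_le k : a k <= expR (t / 2).
  by apply: le_trans (le_exp k.+1); rewrite big_nat_recr//= lerDr sumr_ge0.
apply: (@le_trans _ _ (\sum_(0 <= k < n) bessel_coef m 0 * (a k * expR (t / 2)))).
  apply: ler_sum => k _.
  apply: (@le_trans _ _ (bessel_coef m 0 * (k`!%:R^-1) ^+ 2 * (t ^+ 2 / 4) ^+ k)).
    by rewrite ler_wpM2r ?norm_bessel_coef_le// exprn_ge0// divr_ge0// sqr_ge0.
  rewrite -mulrA ler_pM2l//; apply: (@le_trans _ _ (a k * a k)).
    rewrite /a /exp_coeff/= (_ : t ^+ 2 / 4 = (t / 2) ^+ 2); last by field.
    by rewrite -exprM mulnC exprM -exprMn expr2 [_^-1 * _]mulrC.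
  by rewrite ler_wpM2l.
rewrite -mulr_sumr ler_pM2l// -mulr_suml.
apply: (@le_trans _ _ (expR (t / 2) * expR (t / 2))).
  by rewrite ler_wpM2r ?expR_ge0.
by rewrite -expRD ler_expR; lra.
Qed.

Lemma is_cvg_bessel_pseries m x : 0 < m -> cvgn (pseries (bessel_coef m) x).
Proof.
move=> m0; apply: normed_cvg.
pose t := 2 * Num.sqrt `|x|; have t0 : 0 <= t by rewrite mulr_ge0 ?sqrtr_ge0.
have xE : `|x| = t ^+ 2 / 4 by rewrite exprMn sqr_sqrtr//; field.
have -> : [normed pseries (bessel_coef m) x] =
    series (fun k => `|bessel_coef m k| * (t ^+ 2 / 4) ^+ k).
  apply/funext => n; apply: eq_bigr => k _.
  by rewrite /= normrM normrX xE.
apply: nondecreasing_is_cvgn.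
  apply/nondecreasing_seqP => k; rewrite /series/= big_nat_recr//= lerDl.
  by rewrite mulr_ge0// exprn_ge0// -xE.
exists (bessel_coef m 0 * expR t) => _ [n _ <-].
exact: sum_norm_bessel_le.
Qed.

End bessel_series.

(* Locked, since unification would otherwise unfold the limit of the series. *)
HB.lock Definition bessel_entire (R : realType) (m z : R) : R :=
  limn (pseries (bessel_coef m) z).

Section bessel.
Context {R : realType}.
Implicit Types (m x t z : R) (k n : nat).

Lemma bessel_entireE m z : bessel_entire m z = limn (pseries (bessel_coef m) z).
Proof. by rewrite bessel_entire.unlock. Qed.

Lemma pseriesN (f : nat -> R) z : pseries (fun k => - f k) z = - pseries f z.
Proof.
apply/funext => n; rewrite [RHS]/GRing.opp/= /pseries /series/= -sumrN.
by apply: eq_bigr => k _; rewrite mulNr.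
Qed.

Lemma is_derive_bessel_entire m z : 0 < m ->
  is_derive z 1 (bessel_entire m) (- bessel_entire (m + 1) z).
Proof.
move=> m0; have m10 : 0 < m + 1 by lra. have m20 : 0 < m + 1 + 1 by lra.
(* Termwise differentiation at z needs convergence of the series and of its first two formal
   derivatives at some point of larger modulus; |z| + 1 is such a point. *)
have zK : `|z| < `|(`|z| + 1)| by rewrite (@ger0_norm _ (`|z| + 1)) ?ltrDl ?addr_ge0.
have dE := pseries_diffs_bessel_coef m0.
have -> : - bessel_entire (m + 1) z = limn (pseries (pseries_diffs (bessel_coef m)) z).
  rewrite dE pseriesN limN ?bessel_entireE//; exact: is_cvg_bessel_pseries.
rewrite bessel_entire.unlock; apply: pseries_snd_diffs zK.
- exact: is_cvg_bessel_pseries.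
- by rewrite dE pseriesN; apply: is_cvgN; exact: is_cvg_bessel_pseries.
- have -> : pseries_diffs (pseries_diffs (bessel_coef m)) = bessel_coef (m + 1 + 1).
    rewrite dE; have := pseries_diffs_bessel_coef m10; rewrite /pseries_diffs => h.
    apply/funext => k; have /(congr1 (fun f => f k)) := h.
    by rewrite mulrN => ->; rewrite opprK.
  exact: is_cvg_bessel_pseries.
Qed.

Lemma cvg_bessel_entire m z : 0 < m ->
  pseries (bessel_coef m) z n @[n --> \oo] --> bessel_entire m z.
Proof. by move=> m0; rewrite bessel_entire.unlock; exact: is_cvg_bessel_pseries. Qed.

(** Since E_m' = - E_(m+1) and E_m'' = E_(m+2), this is the Bessel equation z E'' + (m + 1) E' + E =
    0 for E = E_m. *)
Lemma bessel_entire_ode m z : 0 < m ->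
  z * bessel_entire (m + 1 + 1) z - (m + 1) * bessel_entire (m + 1) z +
  bessel_entire m z = 0.
Proof.
move=> m0; have m10 : 0 < m + 1 by lra. have m20 : 0 < m + 1 + 1 by lra.
have dE := pseries_diffs_bessel_coef m10.
have := @pseries_diffs_equiv _ (bessel_coef (m + 1)) z.
rewrite dE pseriesN limN; last exact: is_cvg_bessel_pseries.
have c1 := @cvg_bessel_entire _ z m10; have c0 := @cvg_bessel_entire _ z m0.
have c2 : cvgn (pseries (bessel_coef (m + 1 + 1)) z) := is_cvg_bessel_pseries m20.
move=> /(_ (cvgN c2)); rewrite -bessel_entireE => H.
pose u n := z * series (fun i => i%:R * bessel_coef (m + 1) i * z ^+ i.-1) n.
have H1 : u n @[n --> \oo] --> z * - bessel_entire (m + 1 + 1) z.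
  by apply: cvgM H; exact: cvg_cst.
pose w n := pseries (bessel_coef m) z n - (m + 1) * pseries (bessel_coef (m + 1)) z n.
have H2 : w n @[n --> \oo] --> bessel_entire m z - (m + 1) * bessel_entire (m + 1) z.
  by apply: (cvgB c0); apply: cvgM c1; exact: cvg_cst.
(* The partial sums agree term by term, because k times the coefficient of E_(m+1) is the
   coefficient of E_m minus (m + 1) times that of E_(m+1). In the term of index 0 the truncated
   exponent [i.-1] is harmless, being multiplied by 0. *)
have E : w = u.
  apply/funext => n; rewrite /w /u /pseries /series/= !mulr_sumr -sumrB.
  apply: eq_bigr => -[|k] _.
    by rewrite !mul0r mulr0 bessel_coefS_order//; ring.
  by rewrite bessel_coefS_order//= exprS; ring.
rewrite E in H2; have := cvg_unique _ H2 H1.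
by move=> h; rewrite addrAC -addrA h//; ring.
Qed.

Lemma besselJE m t : 0 < m -> 0 < t ->
  besselJ m t = (t / 2) `^ m * bessel_entire m (t ^+ 2 / 4).
Proof.
move=> m0 t0; rewrite /besselJ bessel_entireE /pseries.
have c0 : cvgn (pseries (bessel_coef m) (t ^+ 2 / 4)) := is_cvg_bessel_pseries m0.
rewrite -[RHS](lim_seriesZ _ c0).
have t20 : 0 < t / 2 by rewrite divr_gt0.
congr (limn (series _)); apply/funext => k; rewrite -/(bessel_coef m k).
rewrite powRD; last by rewrite (gt_eqF t20) implybT.
rewrite -[k%:R *+ 2]mulrnA powR_mulrn ?(ltW t20)//.
rewrite (_ : t ^+ 2 / 4 = (t / 2) ^+ 2) ; last by field.
rewrite [RHS]/GRing.scale/= -exprM mulnC.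
by rewrite [RHS]mulrCA [_ `^ m * _]mulrC mulrA.
Qed.

Lemma norm_bessel_pseries_le m t n : 0 < m -> 0 <= t ->
  `|pseries (bessel_coef m) (t ^+ 2 / 4) n| <= bessel_coef m 0 * expR t.
Proof.
move=> m0 t0; apply: le_trans (sum_norm_bessel_le n m0 t0).
rewrite /pseries /series/=; apply: (le_trans (ler_norm_sum _ _ _)).
apply: ler_sum => k _; rewrite normrM ler_wpM2l//.
by rewrite ger0_norm// exprn_ge0// divr_ge0// sqr_ge0.
Qed.

Lemma norm_bessel_entire_le m t : 0 < m -> 0 <= t ->
  `|bessel_entire m (t ^+ 2 / 4)| <= bessel_coef m 0 * expR t.
Proof.
move=> m0 t0.
have c1 : `|pseries (bessel_coef m) (t ^+ 2 / 4) n| @[n --> \oo] -->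
    `|bessel_entire m (t ^+ 2 / 4)| by apply: cvg_norm; exact: cvg_bessel_entire.
rewrite -(cvg_lim _ c1)//; apply: limr_le; first by apply/cvg_ex; eexists; exact: c1.
by apply: nearW => n; exact: norm_bessel_pseries_le.
Qed.

Definition bessel_sqrt m t : R := Num.sqrt t * besselJ m t.

(** The function v on (0, oo) with its series packed into E_m, so that the usual rules differentiate
    it; the result is [bessel_sqrt_deriv]. *)
Definition bessel_sqrt_fun m t : R :=
  2 `^ (- m) * (t `^ (m + 2^-1) * bessel_entire m (t ^+ 2 / 4)).

Definition bessel_sqrt_deriv m t : R :=
  2 `^ (- m) * ((m + 2^-1) * t `^ (m + 2^-1 - 1) * bessel_entire m (t ^+ 2 / 4) -
    t `^ (m + 2^-1 + 1) / 2 * bessel_entire (m + 1) (t ^+ 2 / 4)).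

Lemma bessel_sqrtE m t : 0 < m -> 0 < t -> bessel_sqrt m t = bessel_sqrt_fun m t.
Proof.
move=> m0 t0; rewrite /bessel_sqrt besselJE// /bessel_sqrt_fun.
rewrite powRM ?(ltW t0)// -powR12_sqrt ?(ltW t0)// powRD; last first.
  by rewrite (gt_eqF t0) implybT.
by rewrite -(@powR_inv1 _ 2)// -powRrM mulN1r; ring.
Qed.

Lemma is_derive_bessel_entire_sqr m t : 0 < m ->
  is_derive t 1 (fun y => bessel_entire m (y ^+ 2 / 4))
    (- bessel_entire (m + 1) (t ^+ 2 / 4) * (t / 2)).
Proof.
move=> m0; have d : is_derive t 1 (fun y => y ^+ 2 / 4) (t / 2).
  by apply: is_derive_eq; rewrite /GRing.scale/=; field.
have := @is_derive1_comp _ (bessel_entire m) (fun y => y ^+ 2 / 4) t _ _ (@is_derive_bessel_entire _ _ m0) d.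
exact.
Qed.

Lemma powRB1 p t : 0 < t -> t `^ (p - 1) = t `^ p / t.
Proof.
move=> t0; rewrite powRB ?(gt_eqF t0) ?implybT// powRr1//; exact: ltW.
Qed.

Lemma powRD1 p t : 0 < t -> t `^ (p + 1) = t `^ p * t.
Proof.
move=> t0; rewrite powRD ?(gt_eqF t0) ?implybT// powRr1//; exact: ltW.
Qed.

Lemma powR_ge1 p t : 1 <= t -> 0 <= p -> 1 <= t `^ p.
Proof. by move=> t1 p0; rewrite -(powRr0 t) ler_powR. Qed.

Lemma is_derive_bessel_sqrt m t : 0 < m -> 0 < t ->
  is_derive t 1 (bessel_sqrt m) (bessel_sqrt_deriv m t).
Proof.
move=> m0 t0.
apply: (@near_eq_is_derive_gt0 _ (bessel_sqrt_fun m)) => //.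
  by move=> y y0; rewrite bessel_sqrtE.
have d1 := is_derive1_powR (m + 2^-1) t0.
have d2 := is_derive_bessel_entire_sqr t m0.
apply: is_derive_eq.
rewrite /bessel_sqrt_deriv /GRing.scale/= powRD1//.
move: (2 `^ _) (t `^ (m + _)) (t `^ (_ - 1)) (bessel_entire m _) (bessel_entire _ _) => A B C D E.
by field.
Qed.

(** The factor sqrt(t) removes the first-order term of Bessel's equation. The proof eliminates E_m
    by means of [bessel_entire_ode] at z = t^2 / 4. *)
Lemma is_derive_bessel_sqrt_deriv m t : 0 < m -> 0 < t ->
  is_derive t 1 (bessel_sqrt_deriv m)
    ((m ^+ 2 - 4^-1) * t ^- 2 * bessel_sqrt m t - bessel_sqrt m t).
Proof.
move=> m0 t0; have m10 : 0 < m + 1 by lra.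
rewrite (bessel_sqrtE m0 t0) /bessel_sqrt_fun.
have d1 := is_derive1_powR (m + 2^-1 - 1) t0.
have d1' := is_derive1_powR (m + 2^-1 + 1) t0.
have d2 := is_derive_bessel_entire_sqr t m0.
have d2' := is_derive_bessel_entire_sqr t m10.
apply: is_derive_eq.
rewrite /GRing.scale/= addrK powRD1// !powRB1//.
have := bessel_entire_ode (t ^+ 2 / 4) m0.
move: (2 `^ _) (t `^ (m + _)) => P Q.
move: (bessel_entire m _) (bessel_entire (m + 1) _) (bessel_entire (m + 1 + 1) _) => A B C ode.
have -> : A = (m + 1) * B - t ^+ 2 / 4 * C by lra.
by field; exact: lt0r_neq0.
Qed.

(** * Boundedness of sqrt(t) J_m(t) and of its derivative *)

Section oscillation.
Context (m : R) (m_ge : 2^-1 <= m).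

Let m0 : 0 < m. Proof. by apply: lt_le_trans m_ge; rewrite invr_gt0. Qed.

Let nu := m ^+ 2 - 4^-1.

(** This is where m >= 1/2 is decisive: q then increases to 1 from below, so the energy decreases
    and v'^2 <= v'^2 / q. *)
Let nu_ge0 : 0 <= nu.
Proof. by rewrite /nu subr_ge0 (_ : 4^-1 = 2^-1 ^+ 2) ?ler_pXn2r ?nnegrE ?(ltW m0)//; field. Qed.

Let q t := 1 - nu * t ^- 2.

(** A point with t0^2 > nu, so that q > 0 from there on; this choice avoids a square root and is at
    least 1. *)
Let t0 := 2 * nu + 1.

Let q_gt0 t : t0 <= t -> 0 < q t.
Proof.
move=> t0t; have tp : 0 < t by apply: lt_le_trans t0t; rewrite /t0; have := nu_ge0; lra.
rewrite /q subr_gt0 ltr_pdivrMr ?exprn_gt0// mul1r.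
apply: (@lt_le_trans _ _ (t0 ^+ 2)); last by rewrite ler_pXn2r ?nnegrE ?(ltW tp)// /t0; have := nu_ge0; lra.
by rewrite /t0; have := nu_ge0; nra.
Qed.

(* With q(t) = 1 - (m^2 - 1/4) t^-2 the equation of v = sqrt(t) J_m(t) reads
   v'' = - q v, so v'^2 / q + v^2 has derivative - q' v'^2 / q^2 <= 0. *)
Let energy t := (bessel_sqrt_deriv m t) ^+ 2 / q t + (bessel_sqrt m t) ^+ 2.

Let t_gt0 t : t0 <= t -> 0 < t.
Proof. by apply: lt_le_trans; rewrite /t0; have := nu_ge0; lra. Qed.

(** By v'' = - q v the term 2 v' v'' / q cancels the derivative of v^2, and q' = 2 nu / t^3. *)
Let is_derive_energy t : t0 <= t ->
  is_derive t 1 energy (- (2 * nu * (bessel_sqrt_deriv m t) ^+ 2 / (t ^+ 3 * q t ^+ 2))).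
Proof.
move=> t0t; have tp := t_gt0 t0t; have qp := q_gt0 t0t.
have d1 := is_derive_bessel_sqrt m0 tp.
have d2 := is_derive_bessel_sqrt_deriv m0 tp.
have t2 : t ^+ 2 != 0 by rewrite expf_neq0// gt_eqF.
have dt2 : is_derive t 1 (fun y : R => y ^+ 2) (2 * t).
  by apply: is_derive_eq; rewrite /GRing.scale/=; ring.
have dt := @is_deriveV _ (fun y : R => y ^+ 2) t _ 1 t2 dt2.
have dq : is_derive t 1 q (2 * nu / t ^+ 3).
  apply: is_derive_eq; rewrite /GRing.scale/=; field; exact: lt0r_neq0.
have qn : q t != 0 by rewrite gt_eqF.
have dqi := @is_deriveV _ q t _ 1 qn dq.
apply: is_derive_eq; rewrite /GRing.scale/=.
rewrite -/nu.
have -> : nu * t ^- 2 = 1 - q t by rewrite /q; ring.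
by field; rewrite qn gt_eqF.
Qed.

Let energy_le t : t0 <= t -> energy t <= energy t0.
Proof.
rewrite le_eqVlt => /predU1P[<-//|t0t].
have cE x : t0 <= x -> {for x, continuous energy}.
  by move=> h; exact: is_derive_continuous (is_derive_energy h).
have [||c] := @MVT _ energy (fun t => - (2 * nu * (bessel_sqrt_deriv m t) ^+ 2 / (t ^+ 3 * q t ^+ 2))) _ _ t0t.
- by move=> x; rewrite in_itv/= => /andP[/ltW tx _]; exact: is_derive_energy.
- apply: continuous_in_subspaceT => x; rewrite inE/= in_itv/= => /andP[tx _]; exact: cE.
rewrite in_itv/= => /andP[/ltW tc _] h; rewrite -subr_le0 h mulNr oppr_le0.
have cp := t_gt0 tc; have qp := q_gt0 tc.
rewrite mulr_ge0 ?subr_ge0 ?(ltW t0t)//.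
rewrite divr_ge0//.
  by rewrite mulr_ge0 ?sqr_ge0// mulr_ge0.
by rewrite mulr_ge0 ?sqr_ge0// exprn_ge0// ltW.
Qed.

Lemma bessel_sqrt_deriv_bounded : exists T M : R,
  [/\ 1 <= T, 0 < M & forall t, T <= t ->
    `|bessel_sqrt m t| <= M /\ `|bessel_sqrt_deriv m t| <= M].
Proof.
(* From x^2 <= e follows |x| <= e + 1, which spares a square root and makes the bound positive. *)
exists t0, (energy t0 + 1).
have tp := t_gt0 (lexx t0); have e0 : 0 <= energy t0.
  by rewrite addr_ge0 ?sqr_ge0// divr_ge0 ?sqr_ge0// ltW// q_gt0.
have sq_le x : x ^+ 2 <= energy t0 -> `|x| <= energy t0 + 1.
  move=> h; have := normr_ge0 x; rewrite -real_normK ?num_real// in h.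
  by move: `|x| h => y; nra.
split; [by rewrite /t0; have := nu_ge0; lra|by lra|move=> t t0t].
have qp := q_gt0 t0t; have E := energy_le t0t.
have a0 : 0 <= bessel_sqrt_deriv m t ^+ 2 / q t by rewrite divr_ge0 ?sqr_ge0// ltW.
have b0 : 0 <= bessel_sqrt m t ^+ 2 by rewrite sqr_ge0.
split; apply: sq_le; first by move: E; rewrite {1}/energy; lra.
apply: (@le_trans _ _ (bessel_sqrt_deriv m t ^+ 2 / q t)).
  rewrite ler_pdivlMr// ler_piMr ?sqr_ge0// /q gerBl mulr_ge0// invr_ge0 sqr_ge0//.
by move: E; rewrite {1}/energy; lra.
Qed.

(** The constant bound serves large t and the power bound serves small t. Up to T they come from the
    growth estimate of E_m, beyond T from the energy. *)
Lemma bessel_sqrt_bounded : exists2 C : R, 0 < C & forall t, 0 < t ->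
  `|bessel_sqrt m t| <= C /\ `|bessel_sqrt m t| <= C * t `^ (m + 2^-1).
Proof.
have [T [M [T1 M0 HM]]] := bessel_sqrt_deriv_bounded.
have b0 := bessel_coef0_gt0 m0.
have entire_le t (tp : 0 < t) := norm_bessel_entire_le m0 (ltW tp).
pose K := 2 `^ (- m) * (bessel_coef m 0 * expR T).
have K0 : 0 < K by rewrite mulr_gt0 ?powR_gt0// mulr_gt0 ?expR_gt0.
have Tm : 1 <= T `^ (m + 2^-1).
  by apply: powR_ge1 => //; have := m0; lra.
have small t : 0 < t -> t <= T -> `|bessel_sqrt m t| <= K * t `^ (m + 2^-1).
  move=> tp tT; rewrite bessel_sqrtE// /bessel_sqrt_fun !normrM.
  rewrite ger0_norm ?powR_ge0// (@ger0_norm _ (t `^ _)) ?powR_ge0//.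
  rewrite /K -mulrA ler_pM2l ?powR_gt0// mulrC ler_wpM2r ?powR_ge0//.
  by rewrite (le_trans (entire_le _ tp))// ler_pM2l// ler_expR.
(* The first summand is the largest value of K t^(m + 1/2) on t <= T. As T >= 1 it also dominates K,
   and t^(m + 1/2) >= 1 beyond T, so a single constant serves all four estimates. *)
exists (K * T `^ (m + 2^-1) + M); first by rewrite addr_gt0// mulr_gt0// powR_gt0; lra.
move=> t tp; have KT : K <= K * T `^ (m + 2^-1) by rewrite ler_pMr.
have [tT|Tt] := leP t T.
  have S := small _ tp tT; split; apply: (le_trans S).
    rewrite (@le_trans _ _ (K * T `^ (m + 2^-1)))//; last by rewrite lerDl ltW.
    rewrite ler_pM2l// ge0_ler_powR ?nnegrE// ?(ltW tp)//; have := m0; lra.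
  by rewrite ler_wpM2r ?powR_ge0//; lra.
have [S _] := HM _ (ltW Tt).
have t1 : 1 <= t `^ (m + 2^-1).
  by apply: powR_ge1; have := m0; lra.
split; first by lra.
apply: (le_trans S); apply: (@le_trans _ _ ((K * T `^ (m + 2^-1) + M) * 1)); first by lra.
by rewrite ler_pM2l//; lra.
Qed.

End oscillation.
End bessel.

(** * Weber's integral *)

Section weber_integral.
Context {R : realType}.
Local Notation mu := (@lebesgue_measure R).
Implicit Types (m x t y z s p q eta : R) (k n : nat).

Lemma Rintegral_dominated_cvg (f_ : nat -> R -> R) (f g : R -> R) :
  (forall n, measurable_fun (@Rplus R) (f_ n)) ->
  (forall x, 0 < x -> f_ n x @[n --> \oo] --> f x) ->
  mu.-integrable (@Rplus R) (EFin \o g) ->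
  (forall n x, 0 < x -> `|f_ n x| <= g x) ->
  \int[mu]_(x in @Rplus R) f_ n x @[n --> \oo] --> \int[mu]_(x in @Rplus R) f x.
Proof.
move=> mf ff ig fg.
have mfE n : measurable_fun (@Rplus R) (EFin \o f_ n) by exact/measurable_EFinP.
have ffE x : Rplus x -> (EFin \o f_ n) x @[n --> \oo] --> (EFin \o f) x.
  by rewrite RplusE => x0; apply: cvg_EFin; [exact: nearW|exact: ff].
have fgE n x : Rplus x -> (`|(EFin \o f_ n) x| <= (EFin \o g) x)%E.
  by rewrite RplusE => x0; rewrite /= lee_fin; exact: fg.
have fing x : Rplus x -> (EFin \o g) x \is a fin_num by [].
have := @dominated_cvg _ _ R mu _ measurable_Rplus _ _ _ mfE ffE fing ig fgE.
have i_f : mu.-integrable (@Rplus R) (EFin \o f).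
  apply: (@lebesgue_integral_dominated_convergence.dominated_integrable _ _ R mu _ _ (fun n => EFin \o f_ n) _ (EFin \o g)) => //.
have fin : (\int[mu]_(x in @Rplus R) (f x)%:E)%E \is a fin_num.
  by apply: integrable_fin_num.
by rewrite -{1}(fineK fin) => /fine_cvg.
Qed.

Lemma integrable_powR_shift q : 1 < q ->
  mu.-integrable (@Rplus R) (EFin \o (fun x => (1 + x) `^ (- q))).
Proof.
move=> q1; have dF x : 0 <= x ->
    is_derive x 1 (fun y => (1 - q)^-1 * (1 + y) `^ (1 - q)) ((1 + x) `^ (- q)).
  move=> x0; have x1 : 0 < 1 + x by lra.
  have d : is_derive x 1 (fun y => 1 + y) 1 by have := is_deriveD (is_derive_cst (1 : R) x (1 : R)) (is_derive_id x (1 : R)); rewrite add0r.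
  have d' := @is_derive1_comp _ (fun z => z `^ (1 - q)) (fun y => 1 + y) x _ _
    (is_derive1_powR (1 - q) x1) d.
  have d2 := is_deriveZ (1 - q)^-1 d'; apply: is_derive_eq.
  rewrite /GRing.scale/= (_ : 1 - q - 1 = - q); last by ring.
  by field; lra.
have cf x : 0 <= x -> {for x, continuous (fun y => (1 + y) `^ (- q))}.
  move=> x0; apply: (@continuous_fun_comp _ (fun y => 1 + y) (fun z => z `^ (- q))).
    by apply: cvgD; [exact: cvg_cst|exact: cvg_id].
  by apply: continuous_powR; lra.
have mf : measurable_fun (@Rplus R) (fun x => (1 + x) `^ (- q)).
  by apply: continuous_Rplus_measurable => x x0; apply: cf; exact: ltW.
apply/integrableP; split; first exact/measurable_EFinP.
under eq_integral do rewrite /= ger0_norm ?powR_ge0//.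
rewrite /Rplus integral_itv_obnd_cbnd; last exact/measurable_EFinP.
have -> : (\int[mu]_(x in `[0%R, +oo[) ((1 + x) `^ (- q))%:E =
    0%:E - ((1 - q)^-1 * (1 + 0) `^ (1 - q))%:E)%E.
  apply: (@ge0_continuous_FTC2y _ _ (fun y => (1 - q)^-1 * (1 + y) `^ (1 - q))).
  - by move=> x _; exact: powR_ge0.
  - apply: continuous_in_subspaceT => x; rewrite inE/= in_itv/= andbT; exact: cf.
  - rewrite -(mulr0 (1 - q)^-1); apply: cvgM; first exact: cvg_cst.
    have -> : (fun x => (1 + x) `^ (1 - q)) = (fun x => ((1 + x) `^ (q - 1))^-1).
      by apply/funext => x; rewrite -powRN opprB.
    apply/gtr0_cvgV0.
      near=> x; rewrite powR_gt0//; suff : 0 < x by lra.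
      by near: x; exact: nbhs_pinfty_gt.
    apply: (@cvg_comp _ _ _ (fun x => 1 + x) (fun z => z `^ (q - 1)) _ +oo).
      exact: cvg_addrl.
    by apply: powR_cvgy; lra.
  - by move=> x x0; have [] := dF _ (ltW x0).
  - by apply: cvg_at_right_filter; exact: is_derive_continuous (dF _ (lexx 0)).
  - move=> x; rewrite in_itv/= andbT => x0; rewrite derive1E.
    by have ? := dF _ (ltW x0); exact: derive_val.
by rewrite sub0e -EFinN ltry.
Unshelve. all: by end_near. Qed.

(** Instead of splitting the integral, a single majorant on (0, oo) is built from a Gamma integrand
    and a shifted power. The factor e compensates e^(-t) on t <= 1, and 2^q compensates 1 + t <= 2 t
    on t >= 1. *)
Lemma integrable_two_powers (f : R -> R) (C s q : R) : 0 < s -> 1 < q ->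
  measurable_fun (@Rplus R) f ->
  (forall t, 0 < t -> t <= 1 -> `|f t| <= C * t `^ (s - 1)) ->
  (forall t, 1 <= t -> `|f t| <= C * t `^ (- q)) ->
  mu.-integrable (@Rplus R) (EFin \o f).
Proof.
move=> s0 q1 mf f0 f1.
have C0 : 0 <= C by have := le_trans (normr_ge0 _) (f1 _ (lexx 1)); rewrite powR1 mulr1.
pose g t := C * expR 1 * gamma_integrand s t + C * 2 `^ q * (1 + t) `^ (- q).
apply: (@le_integrable_EFin _ _ _ g) => //.
  apply: (@integrableD _ _ _ mu _ measurable_Rplus
     (EFin \o (fun t => C * expR 1 * gamma_integrand s t))
     (EFin \o (fun t => C * 2 `^ q * (1 + t) `^ (- q)))).
  - apply: integrableZl_EFin; [exact: measurable_Rplus|exact: integrable_gamma].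
  - apply: integrableZl_EFin; [exact: measurable_Rplus|exact: integrable_powR_shift].
move=> t; rewrite RplusE => t0.
have g1 : 0 <= C * expR 1 * gamma_integrand s t.
  by rewrite !mulr_ge0 ?expR_ge0 ?powR_ge0.
have g2 : 0 <= C * 2 `^ q * (1 + t) `^ (- q) by rewrite !mulr_ge0 ?powR_ge0.
have [t1|/ltW t1] := leP t 1.
  apply: (le_trans (f0 _ t0 t1)); rewrite /g.
  suff : C * t `^ (s - 1) <= C * expR 1 * gamma_integrand s t by lra.
  rewrite -mulrA ler_wpM2l// /gamma_integrand mulrCA ler_peMr ?powR_ge0//.
  by rewrite -expRD -[leLHS]expR0 ler_expR; lra.
apply: (le_trans (f1 _ t1)); rewrite /g.
suff : C * t `^ (- q) <= C * 2 `^ q * (1 + t) `^ (- q) by lra.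
rewrite -mulrA ler_wpM2l// !powRN ler_pdivlMr; last by rewrite powR_gt0; lra.
rewrite mulrC ler_pdivrMr ?powR_gt0// -powRM//; last lra.
by apply: ge0_ler_powR; rewrite ?nnegrE; lra.
Qed.

Lemma continuous_bessel_sqrt m t : 0 < m -> 0 < t ->
  {for t, continuous (bessel_sqrt m)}.
Proof. by move=> m0 t0; exact: is_derive_continuous (is_derive_bessel_sqrt m0 t0). Qed.

Lemma continuous_powR_bessel_sqrt m p t : 0 < m -> 0 < t ->
  {for t, continuous (fun x => x `^ p * bessel_sqrt m x)}.
Proof.
by move=> m0 t0; apply: cvgM; [exact: continuous_powR|exact: continuous_bessel_sqrt].
Qed.

(** At 0 the integrand is O(t^(m + 1 - eta)), integrable because eta < 2 + m; at infinity it is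
    O(t^(1/2 - eta)), integrable because eta > 3/2. *)
Lemma integrable_powR_bessel m eta : 2^-1 <= m -> 3 / 2 < eta -> eta < 2 + m ->
  mu.-integrable (@Rplus R) (EFin \o (fun t => t `^ (2^-1 - eta) * bessel_sqrt m t)).
Proof.
move=> m_ge eta1 eta2; have m0 : 0 < m by lra.
have [C C0 HC] := bessel_sqrt_bounded m_ge.
apply: (@integrable_two_powers _ C (m + 2 - eta) (eta - 2^-1)); [lra|lra| | |].
- by apply: continuous_Rplus_measurable => t; exact: continuous_powR_bessel_sqrt.
- move=> t t0 _; have [_ h] := HC _ t0.
  rewrite normrM ger0_norm ?powR_ge0// (le_trans (ler_wpM2l (powR_ge0 _ _) h))//.
  rewrite mulrCA -powRD ?(gt_eqF t0) ?implybT//.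
  by rewrite (_ : 2^-1 - eta + (m + 2^-1) = m + 2 - eta - 1)//; field.
- move=> t t1; have t0 : 0 < t by lra.
  have [h _] := HC _ t0; rewrite normrM ger0_norm ?powR_ge0// mulrC opprB.
  by rewrite ler_wpM2r ?powR_ge0.
Qed.

(** Term by term, the k-th Gaussian moment contains Gamma(k + m + 1), which cancels the Gamma in
    [bessel_coef]; what remains is the exponential series at - 1 / (4 y). *)
Lemma integral_bessel_gauss m y : 0 < m -> 0 < y ->
  \int[mu]_(t in @Rplus R) (t `^ (m + 2^-1) * bessel_sqrt m t * expR (- y * t ^+ 2)) =
  (2 * y) `^ (- m - 1) * expR (- (4 * y)^-1).
Proof.
move=> m0 y0.
pose u n t := 2 `^ (- m) * (t `^ (2 * m + 1) * pseries (bessel_coef m) (t ^+ 2 / 4) n *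
  expR (- y * t ^+ 2)).
pose w k t := 2 `^ (- m) * (bessel_coef m k * 4^-1 ^+ k) *
  (t `^ (2 * (k%:R + m + 1) - 1) * expR (- y * t ^+ 2)).
have uS n t : 0 < t -> u n.+1 t = u n t + w n t.
  move=> t0; rewrite /u /w /pseries /series/= big_nat_recr//=.
  have -> : t `^ (2 * (n%:R + m + 1) - 1) = t `^ (2 * m + 1) * t ^+ 2 ^+ n.
    rewrite -exprM -powR_mulrn ?(ltW t0)// -powRD ?(gt_eqF t0) ?implybT//.
    by congr (_ `^ _); rewrite natrM; ring.
  by rewrite exprMn exprVn; ring.
have s0 n : 0 < n%:R + m + 1 by have := ler0n R n; lra.
have cw n t : 0 < t -> {for t, continuous (w n)}.
  move=> t0; apply: cvgM; first exact: cvg_cst.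
  apply: cvgM; first exact: continuous_powR.
  apply: (@continuous_fun_comp _ (fun t => t ^+ 2) (fun z => expR (- y * z))).
    exact: exprn_continuous.
  exact: continuous_expRM.
have Iw n : (\int[mu]_(t in @Rplus R)
    (t `^ (2 * (n%:R + m + 1) - 1) * expR (- y * t ^+ 2))%:E =
   (y `^ (- (n%:R + m + 1)) / 2 * Gamma (n%:R + m + 1))%:E)%E.
  exact: integral_gaussian_moment.
have iw0 n : mu.-integrable (@Rplus R)
    (EFin \o (fun t => t `^ (2 * (n%:R + m + 1) - 1) * expR (- y * t ^+ 2))).
  apply/integrableP; split.
    apply/measurable_EFinP; apply: continuous_Rplus_measurable => t t0.
    apply: cvgM; first exact: continuous_powR.
    apply: (@continuous_fun_comp _ (fun t => t ^+ 2) (fun z => expR (- y * z))).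
      exact: exprn_continuous.
    exact: continuous_expRM.
  under eq_integral do rewrite /= ger0_norm ?mulr_ge0 ?powR_ge0 ?expR_ge0//.
  by rewrite Iw ltry.
have iw n : mu.-integrable (@Rplus R) (EFin \o w n).
  by apply: integrableZl_EFin (iw0 n); exact: measurable_Rplus.
have Iw' n : \int[mu]_(t in @Rplus R) w n t =
    (2 * y) `^ (- m - 1) * exp_coeff (- (4 * y)^-1) n.
  rewrite RintegralZl; [|exact: measurable_Rplus|exact: iw0].
  rewrite {1}/Rintegral Iw /= /bessel_coef /exp_coeff/=.
  have g0 : Gamma (n%:R + m + 1) != 0 :> R by rewrite gt_eqF// Gamma_gt0.
  have f0 : n`!%:R != 0 :> R by rewrite pnatr_eq0 -lt0n fact_gt0.
  have -> : y `^ (- (n%:R + m + 1)) = y `^ (- m - 1) * y ^- n.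
    rewrite -powR_invn ?(ltW y0)// -powRD ?(gt_eqF y0) ?implybT//.
    by congr (_ `^ _); ring.
  rewrite (powRM _ _ (ltW y0))// powRB1//.
  have -> : (- (4 * y)^-1) ^+ n = (-1) ^+ n * (4^-1 ^+ n * y ^- n).
    have e : (4 * y)^-1 = 4^-1 * y^-1 by rewrite invfM.
    by rewrite e [LHS]exprNn exprMn !exprVn.
  rewrite powRB1//.
  move: (2 `^ _) (y `^ _) (Gamma _) g0 (n`!%:R) f0 => P Q G g0 F f0.
  have yn : y ^+ n != 0 by rewrite expf_neq0 ?gt_eqF.
  move: (y ^+ n) yn ((-1) ^+ n) (4^-1 ^+ n) => Y Y0 A B.
  by field; rewrite g0 f0 Y0 gt_eqF.
have Iu n : mu.-integrable (@Rplus R) (EFin \o u n) /\ \int[mu]_(t in @Rplus R) u n t =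
   (2 * y) `^ (- m - 1) * series (exp_coeff (- (4 * y)^-1)) n.
  elim: n => [|n [IH1 IH2]].
    have u0 : u 0%N = cst 0.
      by apply/funext => t; rewrite /u /pseries /series/= big_geq// mulr0 mul0r mulr0.
    rewrite u0; split; first exact: integrable0.
    by rewrite Rintegral_cst ?mul0r// /series/= big_geq// mulr0.
  have i2 : mu.-integrable (@Rplus R) (EFin \o (fun t => u n t + w n t)).
    exact: (@integrableD _ _ _ mu _ measurable_Rplus _ _ IH1 (iw n)).
  split.
    apply: eq_integrable i2 => //.
    by move=> t; rewrite inE RplusE => t0 /=; rewrite uS.
  transitivity (\int[mu]_(t in @Rplus R) (u n t + w n t)).
    by apply: eq_Rintegral => t; rewrite inE RplusE => t0; rewrite uS.
  rewrite RintegralD; [|exact: measurable_Rplus|exact: IH1|exact: iw].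
  by rewrite IH2 Iw' -mulrDr /series/= big_nat_recr.
(* The partial sums are O(e^t), and 2 t <= 1/y + y t^2 gives e^t e^(- y t^2) <= e^(1/y) e^(-t), so a
   Gamma integrand dominates them all. *)
pose G t := 2 `^ (- m) * (bessel_coef m 0 * expR (y^-1)) * gamma_integrand (2 * m + 2) t.
have lim : \int[mu]_(t in @Rplus R) u n t @[n --> \oo] -->
    \int[mu]_(t in @Rplus R) (t `^ (m + 2^-1) * bessel_sqrt m t * expR (- y * t ^+ 2)).
  apply: (@Rintegral_dominated_cvg _ _ G).
  - by move=> n; apply/measurable_EFinP; have [/measurable_int] := Iu n.
  - move=> t t0; have -> : t `^ (m + 2^-1) * bessel_sqrt m t * expR (- y * t ^+ 2) =
      2 `^ (- m) * (t `^ (2 * m + 1) * bessel_entire m (t ^+ 2 / 4) * expR (- y * t ^+ 2)).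
      rewrite bessel_sqrtE// /bessel_sqrt_fun.
      rewrite (_ : 2 * m + 1 = m + 2^-1 + (m + 2^-1)); last by field.
      by rewrite (@powRD _ t (m + 2^-1) (m + 2^-1)) ?(gt_eqF t0) ?implybT//; ring.
    apply: cvgM; first exact: cvg_cst.
    apply: cvgM; last exact: cvg_cst.
    by apply: cvgM; [exact: cvg_cst|exact: cvg_bessel_entire].
  - apply: integrableZl_EFin; first exact: measurable_Rplus.
    by apply: integrable_gamma; lra.
  - move=> n t t0; rewrite /u /G /gamma_integrand.
    rewrite normrM (ger0_norm (powR_ge0 _ _)) -[leRHS]mulrA ler_wpM2l ?powR_ge0//.
    rewrite !normrM (ger0_norm (powR_ge0 _ _)) (ger0_norm (expR_ge0 _)).
    rewrite (_ : 2 * m + 2 - 1 = 2 * m + 1); last by ring.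
    rewrite [leRHS]mulrCA -[leLHS]mulrA ler_wpM2l ?powR_ge0//.
    apply: (le_trans (ler_wpM2r (expR_ge0 _) (norm_bessel_pseries_le n m0 (ltW t0)))).
    have b0 := bessel_coef0_gt0 m0.
    move: (bessel_coef m 0) b0 => B B0.
    rewrite -!mulrA ler_pM2l// -!expRD ler_expR.
    rewrite -subr_ge0 (_ : _ - _ = y^-1 * (1 - y * t) ^+ 2).
      by rewrite mulr_ge0 ?sqr_ge0// invr_ge0 ltW.
    by field; rewrite gt_eqF.
have lim2 : \int[mu]_(t in @Rplus R) u n t @[n --> \oo] -->
    (2 * y) `^ (- m - 1) * expR (- (4 * y)^-1).
  under eq_fun => n do rewrite (Iu n).2.
  by apply: cvgM; [exact: cvg_cst|exact: is_cvg_series_exp_coeff].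
exact: cvg_unique lim lim2.
Qed.

(* Write t^(- m - eta) as a Gamma integral of the Gaussians exp(- y t^2) and
   exchange the integrals; the inner one is [integral_bessel_gauss] and the outer
   one becomes a Gamma integral under y -> 1/(4y). *)
Lemma weber_integral m eta : 2^-1 <= m -> 3 / 2 < eta -> eta < 2 + m ->
  \int[mu]_(t in @Rplus R) (t `^ (2^-1 - eta) * bessel_sqrt m t) = Hconst m eta.
Proof.
move=> m_ge eta1 eta2; have m0 : 0 < m by lra.
have i_phi := integrable_powR_bessel m_ge eta1 eta2.
(* The choice of a gives t^(1/2 - eta) = t^(m + 1/2) (t^2)^(-a). After the inner integral the power
   of y is a - 1 - m - 1 = - b - 1. *)
pose a := (eta + m) / 2; pose b := 1 + m / 2 - eta / 2.
have a0 : 0 < a by rewrite /a; lra.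
have b0 : 0 < b by rewrite /b; lra.
have Ga := Gamma_gt0 a0.
pose phi t := t `^ (2^-1 - eta) * bessel_sqrt m t.
pose u t := t `^ (m + 2^-1) * bessel_sqrt m t.
pose w y := y `^ (a - 1).
(* Extension by 0 to the whole plane, where Fubini's theorem is applied. *)
pose f (z : R * R) := (u \_ (@Rplus R)) z.1 * ((w \_ (@Rplus R)) z.2 * expR (- z.2 * z.1 ^+ 2)).
have mu_u : measurable_fun setT (u \_ (@Rplus R)).
  apply/(measurable_restrictT _ _).1; first exact: measurable_Rplus.
  by apply: continuous_Rplus_measurable => t; exact: continuous_powR_bessel_sqrt.
have mu_w : measurable_fun setT (w \_ (@Rplus R)).
  apply/(measurable_restrictT _ _).1; first exact: measurable_Rplus.
  by apply: continuous_Rplus_measurable => t; exact: continuous_powR.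
have mf : measurable_fun setT f.
  apply: measurable_funM; first exact: (measurableT_comp mu_u measurable_fst).
  apply: measurable_funM; first exact: (measurableT_comp mu_w measurable_snd).
  apply: measurableT_comp => //; apply: measurable_funM.
    by apply: measurableT_comp => //; exact: measurable_snd.
  by apply: measurable_funX; exact: measurable_fst.
have powE t : 0 < t -> u t * (Gamma a * (t ^+ 2) `^ (- a)) = Gamma a * phi t.
  move=> t0; rewrite /u /phi -powR_mulrn ?(ltW t0)// -powRrM.
  rewrite (_ : 2^-1 - eta = m + 2^-1 + 2 * - a); last by rewrite /a; field.
  by rewrite [in RHS]powRD ?(gt_eqF t0) ?implybT//; ring.
have Iw t : 0 < t -> (\int[mu]_(y in @Rplus R) (w y * expR (- y * t ^+ 2))%:E =
    (Gamma a * (t ^+ 2) `^ (- a))%:E)%E.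
  by move=> t0; rewrite mulrC; apply: integral_gamma_scale => //; rewrite exprn_gt0.
have iw t : 0 < t -> mu.-integrable (@Rplus R) (EFin \o (fun y => w y * expR (- y * t ^+ 2))).
  move=> t0; apply/integrableP; split.
    apply/measurable_EFinP; apply: continuous_Rplus_measurable => y y0.
    apply: cvgM; first exact: continuous_powR.
    apply: (@continuous_fun_comp _ (fun y => - y * t ^+ 2) expR); last exact: continuous_expR.
    by apply: cvgM; [apply: cvgN; exact: cvg_id|exact: cvg_cst].
  under eq_integral do rewrite /= ger0_norm ?mulr_ge0 ?powR_ge0 ?expR_ge0//.
  by rewrite Iw// ltry.
have fE t y : f (t, y) = (if t \in @Rplus R then u t else 0) *
    ((if y \in @Rplus R then w y else 0) * expR (- y * t ^+ 2)).
  by rewrite /f /= !patchE.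
have restrE (c : R) (k : R -> R) t :
   (fun y => (c * ((if y \in @Rplus R then w y else 0) * k y))%:E) =
   (fun y => (c * (w y * k y))%:E) \_ (@Rplus R).
  by apply/funext => y; rewrite patchE; case: ifP => // _; rewrite mul0r mulr0.
have inner t : (\int[mu]_y (f (t, y))%:E)%E =
    ((EFin \o (fun t => Gamma a * phi t)) \_ (@Rplus R)) t.
  under eq_integral do rewrite fE.
  rewrite restrE// -integral_mkcond patchE; case: ifPn; last first.
    by move=> _; apply: integral0_eq => y _; rewrite mul0r.
  rewrite inE RplusE => t0; under eq_integral do rewrite EFinM.
  rewrite integralZl//=; [|exact: iw].
  by rewrite Iw// -EFinM powE.
have innerN t : (\int[mu]_y `|(f (t, y))%:E|)%E =
    ((EFin \o (fun t => Gamma a * `|phi t|)) \_ (@Rplus R)) t.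
  transitivity (\int[mu]_y
     (`|if t \in @Rplus R then u t else 0| *
     ((if y \in @Rplus R then w y else 0) * expR (- y * t ^+ 2)))%:E)%E.
    apply: eq_integral => y _; rewrite fE /= !normrM (ger0_norm (expR_ge0 _)).
    by case: (y \in _); rewrite ?normr0// (ger0_norm (powR_ge0 _ _)).
  rewrite restrE// -integral_mkcond patchE; case: ifPn; last first.
    by move=> _; apply: integral0_eq => y _; rewrite normr0 mul0r.
  rewrite inE RplusE => t0; under eq_integral do rewrite EFinM.
  rewrite integralZl//=; [|exact: iw].
  rewrite Iw// -EFinM; congr EFin.
  have := congr1 Num.norm (powE _ t0); rewrite !normrM (gtr0_norm Ga).
  by rewrite (ger0_norm (powR_ge0 (t ^+ 2) _)) => ->.
have iphiN : mu.-integrable (@Rplus R) (EFin \o (fun t => Gamma a * `|phi t|)).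
  apply: integrableZl_EFin; first exact: measurable_Rplus.
  exact: integrable_norm.
(* Tonelli's criterion: the weight and the Gaussian are nonnegative, so integrating |f| over y first
   gives Gamma(a) |phi(t)|, which is integrable. *)
have i_f : (mu \x mu)%E.-integrable setT (EFin \o f).
  apply/integrable12ltyP; first exact/measurable_EFinP.
  under eq_integral do rewrite innerN.
  rewrite -integral_mkcond.
  by apply: (@integrable_lty _ _ _ mu).
(* Here u = (t^2)^a phi, and (t^2)^a e^(- y t^2) is bounded, so integrability is inherited from
   phi. *)
have iu y : 0 < y -> mu.-integrable (@Rplus R) (EFin \o (fun t => u t * expR (- y * t ^+ 2))).
  move=> y0; pose k t := t `^ (eta + m) * expR (- y * t ^+ 2).
  have cE t : {for t, continuous (fun t => expR (- y * t ^+ 2))}.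
    apply: (@continuous_fun_comp _ (fun t => t ^+ 2) (fun z => expR (- y * z))).
      exact: exprn_continuous.
    exact: continuous_expRM.
  have [C C0 HC] := @powR_le_expR _ a y (ltW a0) y0.
  apply: (@le_integrable_EFin _ _ _ (fun t => C * `|phi t|)); first exact: measurable_Rplus.
  - apply: continuous_Rplus_measurable => t t0; apply: cvgM; last exact: cE.
    exact: continuous_powR_bessel_sqrt.
  - by apply: integrableZl_EFin; [exact: measurable_Rplus|exact: integrable_norm].
  - move=> t; rewrite RplusE => t0.
    have -> : u t = (t ^+ 2) `^ a * phi t.
      rewrite /u /phi mulrA -powR_mulrn ?(ltW t0)// -powRrM.
      rewrite -powRD ?(gt_eqF t0) ?implybT//; congr (_ `^ _ * _).
      by rewrite /a; field.
    have t2 : 0 < t ^+ 2 by rewrite exprn_gt0.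
    rewrite mulrAC normrM ler_wpM2r// ger0_norm ?mulr_ge0 ?powR_ge0 ?expR_ge0//.
    apply: (le_trans (ler_wpM2r (expR_ge0 _) (HC _ t2))).
    by rewrite -mulrA -expRD mulNr subrr expR0 mulr1.
have outer y : (\int[mu]_t (f (t, y))%:E)%E =
   ((EFin \o (fun y => 2 `^ (- m - 1) * (y `^ (- b - 1) * expR (- (4 * y)^-1)))) \_ (@Rplus R)) y.
  transitivity (\int[mu]_t ((fun t => ((if y \in @Rplus R then w y else 0) *
      (u t * expR (- y * t ^+ 2)))%:E) \_ (@Rplus R)) t)%E.
    apply: eq_integral => t _; rewrite fE [RHS]patchE; case: ifP => // _; last by rewrite mul0r.
    by congr EFin; ring.
  rewrite -integral_mkcond patchE; case: ifPn; last first.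
    by move=> _; apply: integral0_eq => t _; rewrite mul0r.
  rewrite inE RplusE => y0; under eq_integral do rewrite EFinM.
  rewrite integralZl//=; [|exact: iu].
  have fin : (\int[mu]_(t in @Rplus R) (u t * expR (- y * t ^+ 2))%:E)%E \is a fin_num.
    by apply: integrable_fin_num => //; exact: iu.
  rewrite -(fineK fin) -EFinM; congr EFin.
  have -> : fine (\int[mu]_(t in @Rplus R) (u t * expR (- y * t ^+ 2))%:E)%E =
    (2 * y) `^ (- m - 1) * expR (- (4 * y)^-1) by exact: integral_bessel_gauss.
  rewrite powRM ?(ltW y0)// /w; transitivity (2 `^ (- m - 1) * (y `^ (a - 1) * y `^ (- m - 1) * expR (- (4 * y)^-1))); first by ring.
  rewrite -powRD ?(gt_eqF y0) ?implybT//.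
  congr (_ * (_ `^ _ * _)).
  by rewrite /a /b; field.
have := @integral12_prod_meas1 _ _ _ _ R mu mu _ i_f.
rewrite -(@integral21_prod_meas1 _ _ _ _ R mu mu _ i_f).
rewrite /fubini_F /fubini_G.
under eq_integral do rewrite inner.
under [RHS]eq_integral do rewrite outer.
rewrite -!integral_mkcond.
under [RHS]eq_integral do rewrite /= EFinM.
rewrite ge0_integralZl//=; last 2 first.
- apply/measurable_EFinP; apply: continuous_Rplus_measurable => y y0.
  apply: cvgM; first exact: continuous_powR.
  apply: (@continuous_fun_comp _ (fun y => - (4 * y)^-1) expR); last exact: continuous_expR.
  apply: cvgN; apply: cvgV; first by rewrite mulf_neq0// gt_eqF.
  by apply: cvgM; [exact: cvg_cst|exact: cvg_id].
- by move=> y _; rewrite lee_fin mulr_ge0 ?powR_ge0 ?expR_ge0.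
rewrite integral_gamma_inv// -EFinM => /(congr1 fine)/= H.
have {}H : Gamma a * \int[mu]_(t in @Rplus R) phi t = 2 `^ (- m - 1) * (4 `^ b * Gamma b).
  by rewrite -H -RintegralZl//; exact: measurable_Rplus.
apply: (@mulfI _ (Gamma a)); first by rewrite gt_eqF.
rewrite -/(phi _) H /Hconst -/b (_ : m / 2 + eta / 2 = a); last by rewrite /a; field.
have -> : 4 `^ b = 2 `^ (2 * b) :> R.
  by rewrite powRrM powR_mulrn// (_ : 2 ^+ 2 = 4) //; ring.
have -> : 2 `^ (- m - 1) * (2 `^ (2 * b) * Gamma b) = 2 `^ (1 - eta) * Gamma b.
  rewrite mulrA -powRD ?pnatr_eq0 ?implybT//; congr (_ `^ _ * _).
  by rewrite /b; field.
rewrite -opprB powRN; field.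
by rewrite !gt_eqF// powR_gt0.
Qed.

End weber_integral.

(** * The Abelian limit for functions *)

Section abelian_theorem.
Context {R : realType}.
Local Notation mu := (@lebesgue_measure R).
Implicit Types (m x t y s p q c l eta : R).

Lemma continuous_scale (f : R -> R) c : 0 < c ->
  (forall x, 0 < x -> {for x, continuous f}) ->
  forall x, 0 < x -> {for x, continuous (fun x => f (c * x))}.
Proof.
move=> c0 cf x x0; apply: (@continuous_fun_comp _ (fun x => c * x)).
  by apply: cvgM; [exact: cvg_cst|exact: cvg_id].
by apply: cf; rewrite mulr_gt0.
Qed.

Lemma ge0_integral_scale (f : R -> R) c : 0 < c ->
  (forall x, 0 < x -> {for x, continuous f}) -> (forall x, 0 < x -> 0 <= f x) ->
  (\int[mu]_(x in @Rplus R) (c * f (c * x))%:E = \int[mu]_(x in @Rplus R) (f x)%:E)%E.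
Proof.
move=> c0 cf f0.
have F0 x : 0 < x -> 0 < c * x by move=> x0; rewrite mulr_gt0.
have iF u v : 0 < u -> u < v -> c * u < c * v by move=> u0 uv; rewrite ltr_pM2l.
have dF x : 0 < x -> is_derive x 1 (fun t => c * t) (cst c x).
  by move=> x0; have := is_deriveZ c (is_derive_id x (1 : R)); rewrite /GRing.scale/= mulr1.
rewrite [RHS](@ge0_integration_by_substitution_incr0y _ _ _ _ F0 iF dF) //.
- by apply: eq_integral => x _; rewrite mulrC.
- by move=> x x0; exact: cvg_cst.
- rewrite -[X in _ --> X](mulr0 c); apply: cvgM; first exact: cvg_cst.
  exact: cvg_at_right_filter.
- exact: gt0_cvgMry.
Qed.

Lemma integrable_scale (f : R -> R) c : 0 < c ->
  (forall x, 0 < x -> {for x, continuous f}) ->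
  mu.-integrable (@Rplus R) (EFin \o f) ->
  mu.-integrable (@Rplus R) (EFin \o (fun x => c * f (c * x))).
Proof.
move=> c0 cf i_f; apply/integrableP; split.
  apply/measurable_EFinP; apply: continuous_Rplus_measurable => x x0.
  by apply: cvgM; [exact: cvg_cst|exact: continuous_scale].
under eq_integral do rewrite /= normrM (gtr0_norm c0).
rewrite (@ge0_integral_scale (fun x => `|f x|))//.
  by have /integrableP[] := i_f.
by move=> x x0; apply: cvg_norm; exact: cf.
Qed.

(** The rule for nonnegative functions is applied to |f| and to f + |f|, and the two results are
    subtracted. *)
Lemma Rintegral_scale (f : R -> R) c : 0 < c ->
  (forall x, 0 < x -> {for x, continuous f}) ->
  mu.-integrable (@Rplus R) (EFin \o f) ->
  \int[mu]_(x in @Rplus R) (c * f (c * x)) = \int[mu]_(x in @Rplus R) f x.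
Proof.
move=> c0 cf i_f.
have cn x : 0 < x -> {for x, continuous (fun x => `|f x|)}.
  by move=> x0; apply: cvg_norm; exact: cf.
have i_n : mu.-integrable (@Rplus R) (EFin \o (fun x => `|f x|)) by exact: integrable_norm.
have cp x : 0 < x -> {for x, continuous (fun x => f x + `|f x|)}.
  by move=> x0; apply: cvgD; [exact: cf|exact: cn].
have H (g : R -> R) : (forall x, 0 < x -> {for x, continuous g}) -> (forall x, 0 <= g x) ->
  \int[mu]_(x in @Rplus R) (c * g (c * x)) = \int[mu]_(x in @Rplus R) g x.
  by move=> cg g0; rewrite /Rintegral ge0_integral_scale.
have g0 x : 0 <= f x + `|f x| by rewrite -lerBlDl sub0r -normrN ler_norm.
have := H _ cp g0; have := H _ cn (fun x => normr_ge0 _).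
under [\int[mu]_(x in _) (c * (_ + _))]eq_Rintegral do rewrite mulrDr.
have -> : \int[mu]_(x in @Rplus R) (c * f (c * x) + c * `|f (c * x)|) =
  \int[mu]_(x in @Rplus R) (c * f (c * x)) + \int[mu]_(x in @Rplus R) (c * `|f (c * x)|).
  by apply: RintegralD; [exact: measurable_Rplus|exact: integrable_scale|
    exact: (integrable_scale c0 cn i_n)].
have -> : \int[mu]_(x in @Rplus R) (f x + `|f x|) =
  \int[mu]_(x in @Rplus R) f x + \int[mu]_(x in @Rplus R) `|f x|.
  by apply: RintegralD; [exact: measurable_Rplus|exact: i_f|exact: i_n].
move=> -> h; have /addIr : \int[mu]_(x in @Rplus R) (c * f (c * x)) +
  \int[mu]_(x in @Rplus R) `|f x| = \int[mu]_(x in @Rplus R) f x + \int[mu]_(x in @Rplus R) `|f x|.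
  by exact: h.
exact.
Qed.

Lemma integrable_patch (A : set R) (f : R -> R) : measurable A ->
  mu.-integrable A (EFin \o f) -> mu.-integrable (@Rplus R) (EFin \o (f \_ A)).
Proof.
move=> mA i_f; rewrite -restrict_EFin.
have i_T : mu.-integrable setT ((EFin \o f) \_ A).
  apply/(@integrable_mkcond _ _ _ mu A); last exact: i_f.
  exact: mA.
by apply: integrableS i_T => //; exact: measurable_Rplus.
Qed.

(** For x > d one has 1 + x <= (1 + 1/d) x, which reduces the claim to the shifted power. *)
Lemma integrable_powR_tail d q : 0 < d -> 1 < q ->
  mu.-integrable `]d, +oo[ (EFin \o (fun x => x `^ (- q))).
Proof.
move=> d0 q1.
have sub : `]d, +oo[%classic `<=` @Rplus R.
  by move=> x /=; rewrite RplusE in_itv/= andbT; exact: lt_trans.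
apply: (@le_integrable_EFin _ _ _ (fun x => (1 + d^-1) `^ q * (1 + x) `^ (- q))) => //.
- apply: (measurable_funS _ sub) => //.
  by apply: continuous_Rplus_measurable => x x0; exact: continuous_powR.
- apply: integrableZl_EFin => //.
  by apply: (@integrableS _ _ _ mu (@Rplus R)) => //; exact: integrable_powR_shift.
move=> x /=; rewrite in_itv/= andbT => dx; have x0 := lt_trans d0 dx.
have d1 : 0 < 1 + d^-1 by rewrite addr_gt0// invr_gt0.
rewrite ger0_norm ?powR_ge0// !powRN ler_pdivlMr ?powR_gt0//; last by lra.
rewrite mulrC ler_pdivrMr ?powR_gt0// -powRM//; [|exact: ltW|exact: ltW].
apply: ge0_ler_powR; rewrite ?nnegrE ?mulr_ge0 ?(ltW d1) ?(ltW x0)//; [lra|lra|].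
by rewrite mulrDl mul1r addrC lerD2l mulrC ler_pdivlMr// mul1r ltW.
Qed.

Section abelian.
Context (m eta : R) (m_ge : 2^-1 <= m) (eta1 : 3 / 2 < eta) (eta2 : eta < 2 + m).
Context (G : R -> R) (L : R) (mG : measurable_fun (@Rplus R) G).
Context (iG : forall X, 0 < X -> mu.-integrable `]X, +oo[ (EFin \o G)).
Context (GL : x `^ (eta - 2^-1) * G x @[x --> 0^'+] --> L).

Let v := bessel_sqrt m.
Let phi t := t `^ (2^-1 - eta) * v t.

Let m0 : 0 < m. Proof. by have := m_ge; lra. Qed.

Let cphi t : 0 < t -> {for t, continuous phi}.
Proof. exact: continuous_powR_bessel_sqrt. Qed.

Let i_phi : mu.-integrable (@Rplus R) (EFin \o phi).
Proof. exact: integrable_powR_bessel. Qed.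

(** The exponent splits as 3/2 - eta = 1 + (1/2 - eta): the 1 is the factor of a mass-preserving
    dilation and the rest belongs to [phi]. *)
Let phiE l x : 0 < l -> 0 < x ->
  l `^ (3 / 2 - eta) * (v (l * x) * G x) = l * phi (l * x) * (x `^ (eta - 2^-1) * G x).
Proof.
move=> l0 x0; rewrite /phi powRM ?(ltW l0) ?(ltW x0)//.
have -> : 3 / 2 - eta = 1 + (2^-1 - eta) by field.
rewrite (@powRD _ l 1 (2^-1 - eta)) ?(gt_eqF l0) ?implybT// powRr1 ?(ltW l0)//.
transitivity (l * l `^ (2^-1 - eta) * v (l * x) * G x *
   (x `^ (2^-1 - eta) * x `^ (eta - 2^-1))); last by ring.
rewrite -powRD ?(gt_eqF x0) ?implybT// (_ : 2^-1 - eta + (eta - 2^-1) = 0); last by ring.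
by rewrite powRr0; ring.
Qed.

Let near0 (e : R) : 0 < e -> exists2 d : R, 0 < d &
  forall x, 0 < x -> x <= d -> `|x `^ (eta - 2^-1) * G x - L| <= e.
Proof.
move=> e0; have /cvgrPdist_le/(_ _ e0)[d /= d0 H] := GL.
exists (d / 2); first by rewrite divr_gt0.
move=> x x0 xd; rewrite distrC; apply: H => //=.
by rewrite sub0r normrN gtr0_norm//; lra.
Qed.

(* Majorant of the kernel on x > d, where [phi (l * x)] is only controlled by the
   boundedness of [v]; near 0 the closeness of x^(eta - 1/2) G to L is used. *)
Let W (d : R) := (fun x => `|G x| + `|L| * x `^ (2^-1 - eta)) \_ `]d, +oo[.

Let iW d : 0 < d -> mu.-integrable (@Rplus R) (EFin \o W d).
Proof.
move=> d0; apply: integrable_patch => //.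
apply: (@integrableD _ _ _ mu _ _ (EFin \o (fun x => `|G x|))
  (EFin \o (fun x => `|L| * x `^ (2^-1 - eta)))) => //.
  exact: (integrable_norm (iG d0)).
apply: integrableZl_EFin => //; rewrite -opprB; apply: integrable_powR_tail => //.
by have := eta1; lra.
Qed.

(** For x <= d the majorant [W] vanishes and closeness to L is used. For x > d the terms in G and in
    L are estimated separately; each carries l^(3/2 - eta) v(l x), hence a vanishing power of l. *)
Let bound (e d C : R) : 0 < d -> 0 < C -> (forall t, 0 < t -> `|v t| <= C) ->
  (forall x, 0 < x -> x <= d -> `|x `^ (eta - 2^-1) * G x - L| <= e) ->
  forall l x, 0 < l -> 0 < x ->
  `|l * phi (l * x) * (x `^ (eta - 2^-1) * G x - L)| <=
  e * (l * `|phi (l * x)|) + l `^ (3 / 2 - eta) * C * W d x.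
Proof.
move=> d0 C0 vC Hd l x l0 x0; have lx : 0 < l * x by rewrite mulr_gt0.
have [xd|dx] := leP x d.
  have h := Hd _ x0 xd; rewrite /W patchE memNset; last first.
    by rewrite /= in_itv/= andbT; apply/negP; rewrite -leNgt.
  rewrite mulr0 addr0 !normrM (gtr0_norm l0) mulrC.
  by rewrite ler_wpM2r// mulr_ge0// ltW.
have e0 : 0 <= e.
  by apply: le_trans (Hd _ d0 (lexx _)).
rewrite /W patchE mem_set/=; last by rewrite in_itv/= andbT.
rewrite -[leLHS]add0r lerD ?mulr_ge0 ?(ltW l0)//.
have lp : 0 <= l `^ (3 / 2 - eta) by exact: powR_ge0.
rewrite mulrBr -phiE//; apply: (le_trans (ler_normB _ _)).
rewrite mulrDr lerD//.
  by rewrite normrM (ger0_norm lp) -[leRHS]mulrA ler_wpM2l// normrM ler_wpM2r//; exact: vC.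
have -> : l * phi (l * x) = l `^ (3 / 2 - eta) * v (l * x) * x `^ (2^-1 - eta).
  rewrite /phi powRM ?(ltW l0) ?(ltW x0)//.
  have -> : 3 / 2 - eta = 1 + (2^-1 - eta) by field.
  by rewrite (@powRD _ l 1 (2^-1 - eta)) ?(gt_eqF l0) ?implybT// powRr1 ?(ltW l0)//; ring.
rewrite normrM [X in X * _]normrM [X in X * _ * _]normrM.
rewrite (ger0_norm lp) (ger0_norm (powR_ge0 x _)) [`|L| * _]mulrC -!mulrA.
rewrite ler_wpM2l// ler_wpM2r//; last exact: vC.
by rewrite mulr_ge0 ?powR_ge0.
Qed.

Let mdiff l : 0 < l ->
  measurable_fun (@Rplus R) (fun x => l * phi (l * x) * (x `^ (eta - 2^-1) * G x - L)).
Proof.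
move=> l0; apply: measurable_funM.
  apply: continuous_Rplus_measurable => x x0.
  by apply: cvgM; [exact: cvg_cst|exact: (continuous_scale l0 cphi)].
apply: measurable_funB => //; apply: measurable_funM => //.
by apply: continuous_Rplus_measurable => x x0; exact: continuous_powR.
Qed.

Let ibound (e d C l : R) : 0 < d -> 0 < l ->
  mu.-integrable (@Rplus R)
    (EFin \o (fun x => e * (l * `|phi (l * x)|) + l `^ (3 / 2 - eta) * C * W d x)).
Proof.
move=> d0 l0.
apply: (@integrableD _ _ _ mu _ _ (EFin \o (fun x => e * (l * `|phi (l * x)|)))
  (EFin \o (fun x => l `^ (3 / 2 - eta) * C * W d x))); first exact: measurable_Rplus.
  apply: integrableZl_EFin; first exact: measurable_Rplus.
  apply: (@integrable_scale (fun x => `|phi x|)) => //; last exact: integrable_norm.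
  by move=> x x0; apply: cvg_norm; exact: cphi.
by apply: integrableZl_EFin; [exact: measurable_Rplus|exact: iW].
Qed.

Let idiff l : 0 < l -> mu.-integrable (@Rplus R)
  (EFin \o (fun x => l * phi (l * x) * (x `^ (eta - 2^-1) * G x - L))).
Proof.
move=> l0; have [d d0 Hd] := near0 ltr01; have [C C0 HC] := bessel_sqrt_bounded m_ge.
have vC t : 0 < t -> `|v t| <= C by move=> /HC[].
apply: (@le_integrable_EFin _ _ _ _ _ _ (ibound 1 C d0 l0)).
- exact: measurable_Rplus.
- exact: mdiff.
- by move=> x; rewrite RplusE => x0; exact: bound.
Qed.

Let ikernel l : 0 < l -> mu.-integrable (@Rplus R)
  (EFin \o (fun x => l * phi (l * x) * (x `^ (eta - 2^-1) * G x))).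
Proof.
move=> l0.
have i1 := idiff l0.
have i2 : mu.-integrable (@Rplus R) (EFin \o (fun x => L * (l * phi (l * x)))).
  by apply: integrableZl_EFin; [exact: measurable_Rplus|exact: (integrable_scale l0 cphi)].
have i3 := @integrableD _ _ _ mu _ measurable_Rplus _ _ i1 i2.
apply: eq_integrable i3 => //.
by move=> x _ /=; rewrite -EFinD; congr EFin; ring.
Qed.

Lemma integrable_bessel_kernel l : 0 < l ->
  mu.-integrable (@Rplus R) (EFin \o (fun x => bessel_sqrt m (l * x) * G x)).
Proof.
move=> l0; have lp : 0 < l `^ (3 / 2 - eta) by exact: powR_gt0.
have i1 : mu.-integrable (@Rplus R) (EFin \o (fun x =>
    (l `^ (3 / 2 - eta))^-1 * (l * phi (l * x) * (x `^ (eta - 2^-1) * G x)))).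
  by apply: integrableZl_EFin; [exact: measurable_Rplus|exact: ikernel].
apply: eq_integrable i1 => //.
move=> x; rewrite inE RplusE => x0 /=; rewrite -phiE// mulKf ?gt_eqF//.
Qed.

Lemma cvg_bessel_kernel :
  l `^ (3 / 2 - eta) * \int[mu]_(x in @Rplus R) (bessel_sqrt m (l * x) * G x)
    @[l --> +oo] --> L * Hconst m eta.
Proof.
have [C C0 HC] := bessel_sqrt_bounded m_ge.
have vC t : 0 < t -> `|v t| <= C by move=> /HC[].
pose K := \int[mu]_(x in @Rplus R) `|phi x|.
have K0 : 0 <= K by apply: Rintegral_ge0 => x _.
apply/cvgrPdist_le => e e0.
(* The inner part of the error is at most e' K <= e / 2; K + 1 is used because K is only known to be
   nonnegative. *)
pose e' := e / (2 * (K + 1)).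
have e'0 : 0 < e' by rewrite divr_gt0// mulr_gt0//; lra.
have [d d0 Hd] := near0 e'0.
pose IW := \int[mu]_(x in @Rplus R) W d x.
have lim0 : l `^ (3 / 2 - eta) * (C * IW) @[l --> +oo] --> 0.
  rewrite -[X in _ --> X](mul0r (C * IW)); apply: cvgM; last exact: cvg_cst.
  have -> : (fun l => l `^ (3 / 2 - eta)) = (fun l => (l `^ (eta - 3 / 2))^-1).
    by apply/funext => l; rewrite -powRN opprB.
  apply/gtr0_cvgV0; last by apply: powR_cvgy; have := eta1; lra.
  by near=> l; rewrite powR_gt0//; near: l; exact: nbhs_pinfty_gt.
near=> l.
have l0 : 0 < l by near: l; exact: nbhs_pinfty_gt.
have IWe : l `^ (3 / 2 - eta) * (C * IW) <= e / 2.
  near: l; have /cvgrPdist_le/(_ (e / 2)) := lim0.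
  rewrite divr_gt0// => /(_ isT); apply: filterS => l.
  by rewrite sub0r normrN; exact: le_trans (ler_norm _).
have ik := integrable_bessel_kernel l0.
(* [Hconst] is the mass of phi by Weber's integral, and dilation keeps this mass, so the constant L
   can be moved under the integral sign. *)
have E : l `^ (3 / 2 - eta) * \int[mu]_(x in @Rplus R) (bessel_sqrt m (l * x) * G x)
   - L * Hconst m eta =
   \int[mu]_(x in @Rplus R) (l * phi (l * x) * (x `^ (eta - 2^-1) * G x - L)).
  rewrite -(weber_integral m_ge eta1 eta2) -(Rintegral_scale l0 cphi i_phi).
  have isc := integrable_scale l0 cphi i_phi.
  rewrite -RintegralZl; [|exact: measurable_Rplus|exact: ik].
  rewrite -RintegralZl; [|exact: measurable_Rplus|exact: isc].
  rewrite -RintegralB; [|exact: measurable_Rplus| |].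
  - by apply: eq_Rintegral => x; rewrite inE RplusE => x0; rewrite phiE//; ring.
  - by apply: integrableZl_EFin => //; exact: measurable_Rplus.
  - by apply: integrableZl_EFin => //; exact: measurable_Rplus.
rewrite distrC E.
apply: (@le_trans _ _ (\int[mu]_(x in @Rplus R)
   `|l * phi (l * x) * (x `^ (eta - 2^-1) * G x - L)|)).
  by apply: le_normr_Rintegral; [exact: measurable_Rplus|exact: idiff].
apply: (@le_trans _ _ (\int[mu]_(x in @Rplus R)
   (e' * (l * `|phi (l * x)|) + l `^ (3 / 2 - eta) * C * W d x))).
  apply: le_Rintegral; [exact: measurable_Rplus| |exact: ibound|].
  - exact: (integrable_norm (idiff l0)).
  - by move=> x; rewrite RplusE => x0; exact: bound.
have cn x : 0 < x -> {for x, continuous (fun x => `|phi x|)}.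
  by move=> x0; apply: cvg_norm; exact: cphi.
have i_n : mu.-integrable (@Rplus R) (EFin \o (fun x => `|phi x|)) by exact: integrable_norm.
have isc := integrable_scale l0 cn i_n.
rewrite RintegralD; [|exact: measurable_Rplus| |].
- have -> : \int[mu]_(x in @Rplus R) (e' * (l * `|phi (l * x)|)) =
    e' * \int[mu]_(x in @Rplus R) (l * `|phi (l * x)|).
    by apply: RintegralZl; [exact: measurable_Rplus|exact: isc].
  have -> : \int[mu]_(x in @Rplus R) (l `^ (3 / 2 - eta) * C * W d x) =
    l `^ (3 / 2 - eta) * C * IW.
    by apply: RintegralZl; [exact: measurable_Rplus|exact: iW].
  rewrite (Rintegral_scale l0 cn i_n) -/K.
  have : e' * K <= e / 2.
    rewrite /e' mulrAC ler_pdivrMr ?mulr_gt0//; last lra.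
    by rewrite [leRHS](_ : _ = e * (K + 1)) ?ler_pM2l//; [lra|field].
  by move: IWe; rewrite mulrA; lra.
- by apply: integrableZl_EFin => //; exact: measurable_Rplus.
- by apply: integrableZl_EFin; [exact: measurable_Rplus|exact: iW].
Unshelve. all: by end_near. Qed.

End abelian.
End abelian_theorem.

(** * Derivatives of dilated functions and cut-offs *)

Section finite_differentiability.
Context {R : realType}.
Implicit Types (P : (R -> R) -> Prop) (f g : R -> R) (x y t : R) (n k : nat).

(* [f] is [n] times differentiable on (0, oo) and [P] holds of [f] and of its
   first [n] derivatives. *)
Fixpoint n_diff P n f : Prop :=
  P f /\ if n is n'.+1
         then exists2 g : R -> R, (forall x, 0 < x -> is_derive x 1 f (g x)) & n_diff P n' g
         else True.

Lemma n_diff_base P n f : n_diff P n f -> P f.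
Proof. by case: n => [|n] []. Qed.

Lemma n_diffW P n f : n_diff P n.+1 f -> n_diff P n f.
Proof.
elim: n f => [|n IH] f [Pf [g dg ng]]; split=> //.
by exists g => //; exact: IH.
Qed.

Lemma n_diff_cst P n (c : R) : P (cst 0) -> P (cst c) -> n_diff P n (cst c).
Proof.
move=> P0; elim: n c => [|n IH] c Pc; split => //.
exists (cst 0); last exact: (IH 0 P0).
by move=> x _; exact: is_derive_cst.
Qed.

Lemma n_diffD P n f g : (forall f g, P f -> P g -> P (fun x => f x + g x)) ->
  n_diff P n f -> n_diff P n g -> n_diff P n (fun x => f x + g x).
Proof.
move=> PD; elim: n f g => [|n IH] f g [Pf Hf] [Pg Hg]; split; try exact: PD.
  by [].
case: Hf => f' df nf; case: Hg => g' dg ng; exists (fun x => f' x + g' x).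
  by move=> x x0; exact: (is_deriveD (df _ x0) (dg _ x0)).
exact: IH.
Qed.

Lemma n_diffZ P n (c : R) f : (forall f, P f -> P (fun x => c * f x)) ->
  n_diff P n f -> n_diff P n (fun x => c * f x).
Proof.
move=> PZ; elim: n f => [|n IH] f [Pf Hf]; split; try exact: PZ.
  by [].
case: Hf => f' df nf; exists (fun x => c * f' x).
  by move=> x x0; exact: (is_deriveZ c (df _ x0)).
exact: IH.
Qed.

Lemma n_diffM P n f g : (forall f g, P f -> P g -> P (fun x => f x + g x)) ->
  (forall f g, P f -> P g -> P (fun x => f x * g x)) ->
  n_diff P n f -> n_diff P n g -> n_diff P n (fun x => f x * g x).
Proof.
move=> PD PM; elim: n f g => [|n IH] f g nf ng.
  by split => //; exact: (PM _ _ (n_diff_base nf) (n_diff_base ng)).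
have nf' := n_diffW nf; have ng' := n_diffW ng.
case: nf => Pf [f' df nf]; case: ng => Pg [g' dg ng]; split; first exact: PM.
exists (fun x => f x * g' x + g x * f' x).
  by move=> x x0; have := is_deriveM (df _ x0) (dg _ x0).
by apply: n_diffD => //; exact: IH.
Qed.

Lemma n_diff_inv n f : (forall x, 0 < x -> f x != 0) ->
  n_diff (fun=> True) n f -> n_diff (fun=> True) n (fun x => (f x)^-1).
Proof.
move=> f0; elim: n => [|n IH] nf; first by [].
have ni := IH (n_diffW nf); case: nf => _ [f' df nf]; split => //.
exists (fun x => -1 * ((f x)^-1 * (f x)^-1 * f' x)).
  move=> x x0; apply: (is_derive_ext (@is_deriveV _ f x _ 1 (f0 _ x0) (df _ x0))).
  rewrite /GRing.scale/= expr2 invfM; ring.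
by apply: n_diffZ => //; apply: n_diffM => //; exact: n_diffM.
Qed.

Lemma n_diff_scale n (c : R) f : 0 < c ->
  n_diff (fun=> True) n f -> n_diff (fun=> True) n (fun x => f (c * x)).
Proof.
move=> c0; elim: n f => [|n IH] f [_ Hf]; split => //.
case: Hf => f' df nf; exists (fun x => c * f' (c * x)).
  move=> x x0; have cx : 0 < c * x by rewrite mulr_gt0.
  have d : is_derive x 1 (fun y => c * y) c.
    by have := is_deriveZ c (is_derive_id x (1 : R)); rewrite /GRing.scale/= mulr1.
  by have := @is_derive1_comp _ f (fun y => c * y) x _ _ (df _ cx) d; rewrite mulrC.
by apply: n_diffZ => //; exact: IH.
Qed.

Lemma eq_derive1n f g n : (forall x, 0 < x -> f x = g x) ->
  forall x, 0 < x -> derive1n n f x = derive1n n g x.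
Proof.
elim: n => [//|n IH] fg x x0; rewrite /derive1n /= !derive1E.
apply: near_eq_derive; near=> y; apply: IH => //.
by near: y; exact: nbhs_gt0.
Unshelve. all: by end_near. Qed.

Lemma derive1nSE f f' n : (forall x, 0 < x -> is_derive x 1 f (f' x)) ->
  forall x, 0 < x -> derive1n n.+1 f x = derive1n n f' x.
Proof.
move=> df x x0; rewrite /derive1n iterSr; apply: (eq_derive1n n) => // y y0.
exact: derive1_gt0E.
Qed.

Lemma n_diff_derivable P n f : n_diff P n.+1 f ->
  forall x, 0 < x -> derivable (derive1n n f) x 1.
Proof.
elim: n f => [|n IH] f [_ [f' df nf]] x x0; first by have [] := df _ x0.
apply: (near_eq_derivable _ (IH _ nf _ x0)).
near=> y; rewrite (derive1nSE _ df)//.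
by near: y; exact: nbhs_gt0.
Unshelve. all: by end_near. Qed.

Lemma derive1nD P n f g : n_diff P n f -> n_diff P n g ->
  forall x, 0 < x -> derive1n n (fun x => f x + g x) x = derive1n n f x + derive1n n g x.
Proof.
elim: n f g => [//|n IH] f g [_ [f' df nf]] [_ [g' dg ng]] x x0.
rewrite (derive1nSE _ df)// (derive1nSE _ dg)//.
have d y : 0 < y -> is_derive y 1 (fun x => f x + g x) (f' y + g' y).
  by move=> y0; exact: (is_deriveD (df _ y0) (dg _ y0)).
by rewrite (derive1nSE _ d)//; exact: IH.
Qed.

Lemma derive1nZ P n (c : R) f : n_diff P n f ->
  forall x, 0 < x -> derive1n n (fun x => c * f x) x = c * derive1n n f x.
Proof.
elim: n f => [//|n IH] f [_ [f' df nf]] x x0.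
have d y : 0 < y -> is_derive y 1 (fun x => c * f x) (c * f' y).
  by move=> y0; exact: (is_deriveZ c (df _ y0)).
by rewrite (derive1nSE _ df)// (derive1nSE _ d)//; exact: IH.
Qed.

Lemma derive1n_locally0 f (a b : R) n : (forall x, a < x -> x < b -> f x = 0) ->
  forall x, a < x -> x < b -> derive1n n f x = 0.
Proof.
elim: n => [//|n IH] f0 x ax xb; rewrite /derive1n /= derive1E.
rewrite (@near_eq_derive _ _ _ _ (cst 0)) ?derive_cst//.
near=> y; apply: IH => //; near: y; [exact: lt_nbhsr|exact: lt_nbhsl].
Unshelve. all: by end_near. Qed.

Definition bounded_from (T : R) f := exists M : R, forall t, T <= t -> `|f t| <= M.

Lemma bounded_fromD T f g : bounded_from T f -> bounded_from T g ->
  bounded_from T (fun x => f x + g x).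
Proof.
move=> [M HM] [N HN]; exists (M + N) => t Tt.
by rewrite (le_trans (ler_normD _ _))// lerD ?HM ?HN.
Qed.

Lemma bounded_fromM T f g : bounded_from T f -> bounded_from T g ->
  bounded_from T (fun x => f x * g x).
Proof.
move=> [M HM] [N HN]; exists (M * N) => t Tt.
by rewrite normrM ler_pM ?HM ?HN.
Qed.

Definition supported_in (a b : R) f := (exists M : R, forall x, 0 < x -> `|f x| <= M) /\
  (forall x, 0 < x -> x < a \/ b < x -> f x = 0).

(** Vanishing on the open sets x < a and x > b passes to derivatives. Boundedness on [a, b] comes
    from continuity, which costs one further order of differentiability. *)
Lemma n_diff_supported_in (a b : R) n f : 0 < a -> a <= b ->
  (forall x, 0 < x -> x < a \/ b < x -> f x = 0) ->
  n_diff (fun=> True) n.+1 f -> n_diff (supported_in a b) n f.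
Proof.
move=> a0 ab; elim: n f => [|n IH] f f0 nf.
  split => //; split => //.
  case: nf => _ [f' df _].
  have cf : {within `[a, b], continuous (fun x => `|f x|)}.
    apply: continuous_in_subspaceT => x; rewrite inE/= in_itv/= => /andP[ax _].
    apply: cvg_norm; apply: is_derive_continuous (df _ _); exact: lt_le_trans ax.
  have [c cab Hc] := EVT_max ab cf.
  exists `|f c| => x x0; have [xa|ax] := ltP x a; first by rewrite f0 ?normr0//; left.
  have [bx|xb] := ltP b x; first by rewrite f0 ?normr0//; right.
  by apply: Hc; rewrite in_itv/= ax xb.
have Pf := n_diff_base (IH _ f0 (n_diffW nf)).
case: nf => _ [f' df nf]; split => //; exists f' => //; apply: IH => // x x0 xab.
rewrite -(derive1_gt0E df)//.
case: xab => [xa|bx].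
  by apply: (@derive1n_locally0 f 0 a 1) => // y y0 ya; apply: f0 => //; left.
apply: (@derive1n_locally0 f b (x + 1) 1) => //; last by rewrite ltrDl.
by move=> y yb _; apply: f0; [lra|right].
Qed.

(* The factor a in [T <= l * a] keeps l x in the range where the derivatives of g
   are bounded, for every x in the support of f. *)
Lemma derive1n_dilated_le (a b T : R) n f g : 0 < a ->
  n_diff (supported_in a b) n f -> n_diff (bounded_from T) n g ->
  exists2 C : R, 0 <= C & forall l x, 1 <= l -> T <= l * a -> 0 < x ->
    `|derive1n n (fun x => f x * g (l * x)) x| <= C * l ^+ n.
Proof.
move=> a0; elim: n f g => [|n IH] f g nf ng.
  have [[M HM] f0] := n_diff_base nf; have [N HN] := n_diff_base ng.
  exists (Num.max 0 (M * N)); first by rewrite le_max lexx.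
  move=> l x l1 Tla x0; rewrite expr0 mulr1 /derive1n/=.
  have [xa|ax] := ltP x a; first by rewrite f0 ?mul0r ?normr0 ?le_max ?lexx//; left.
  rewrite normrM le_max ler_pM ?orbT ?HM//.
  by apply: HN; rewrite (le_trans Tla)// ler_wpM2l//; lra.
have trueW P m u : n_diff P m u -> n_diff (fun=> True) m u.
  by elim: m u => [//|m IHm] u [_ [u' du nu]]; split => //; exists u' => //; exact: IHm.
have nf1 := n_diffW nf; have ng1 := n_diffW ng.
case: nf => Pf [f' df nf]; case: ng => Pg [g' dg ng].
have [C1 C10 H1] := IH _ _ nf ng1; have [C2 C20 H2] := IH _ _ nf1 ng.
exists (C1 + C2); first exact: addr_ge0.
move=> l x l1 Tla x0; have l0 : 0 < l by lra.
have dgl y : 0 < y -> is_derive y 1 (fun y => g (l * y)) (l * g' (l * y)).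
  move=> y0; have ly : 0 < l * y by rewrite mulr_gt0.
  have d : is_derive y 1 (fun y => l * y) l.
    by have := is_deriveZ l (is_derive_id y (1 : R)); rewrite /GRing.scale/= mulr1.
  by have := @is_derive1_comp _ g (fun y => l * y) y _ _ (dg _ ly) d; rewrite mulrC.
(* One Leibniz step: only the term in which g is differentiated gains a factor l; the other is one
   power of l short, which l >= 1 absorbs. *)
have d1 y : 0 < y -> is_derive y 1 (fun y => f y * g (l * y))
    (f' y * g (l * y) + l * (f y * g' (l * y))).
  move=> y0; apply: (is_derive_ext (is_deriveM (df _ y0) (dgl _ y0))).
  by rewrite /GRing.scale/=; ring.
have n1 : n_diff (fun=> True) n (fun y => f' y * g (l * y)).
  by apply: n_diffM => //; [exact: trueW nf|apply: n_diff_scale => //; exact: trueW ng1].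
have n2 : n_diff (fun=> True) n (fun y => f y * g' (l * y)).
  by apply: n_diffM => //; [exact: trueW nf1|apply: n_diff_scale => //; exact: trueW ng].
rewrite (derive1nSE _ d1)// (derive1nD n1 (n_diffZ _ n2))// (derive1nZ l n2)//.
apply: (le_trans (ler_normD _ _)); rewrite mulrDl lerD//.
  apply: (le_trans (H1 _ _ l1 Tla x0)); rewrite ler_wpM2l// exprS ler_peMl//.
  by rewrite exprn_ge0// ltW.
rewrite normrM (gtr0_norm l0) exprS mulrCA ler_pM2l//; exact: H2.
Qed.

End finite_differentiability.

(** * A smooth cut-off built from exp(-1/s) *)

Section smooth_cutoff.
Context {R : realType}.
Implicit Types (a b s x : R) (n k : nat).

(** The inverse powers of s are included so that the family is closed under differentiation. *)
Definition exp_inv k s : R := if s <= 0 then 0 else s^-1 ^+ k * expR (- s^-1).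

(** From u^(k+1) <= (k+1)! e^u at u = 1/s. The bound is linear in s so as to yield continuity at
    0. *)
Lemma exp_inv_le k : exists2 C : R, 0 < C & forall s, `|exp_inv k s| <= C * `|s|.
Proof.
exists (k.+1`!%:R); first by rewrite ltr0n fact_gt0.
move=> s; rewrite /exp_inv; have [s0|s0] := leP s 0; first by rewrite normr0 mulr_ge0.
have t0 : 0 < s^-1 by rewrite invr_gt0.
rewrite (gtr0_norm s0) ger0_norm; last by rewrite mulr_ge0 ?expR_ge0// exprn_ge0// ltW.
rewrite -ler_pdivrMr// mulrC mulrA -exprS expRN ler_pdivrMr ?expR_gt0//.
rewrite mulrC -ler_pdivrMr ?ltr0n ?fact_gt0//.
by have := expR_ge1Dxn k (ltW t0); lra.
Qed.

Lemma is_derive_exp_inv k s :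
  is_derive s 1 (exp_inv k) (- k%:R * exp_inv k.+1 s + exp_inv k.+2 s).
Proof.
have [s0|s0|->] := ltgtP s 0.
- rewrite /exp_inv (ltW s0) mulr0 addr0.
  apply: (near_eq_is_derive (f := cst 0)).
  by near=> y; rewrite ifT//; apply: ltW; near: y; exact: lt_nbhsl.
- have -> : - k%:R * exp_inv k.+1 s + exp_inv k.+2 s =
     - k%:R * (s^-1 ^+ k.+1 * expR (- s^-1)) + s^-1 ^+ k.+2 * expR (- s^-1).
    by rewrite /exp_inv leNgt s0.
  apply: (near_eq_is_derive (f := fun s => s^-1 ^+ k * expR (- s^-1))).
    by near=> y; rewrite /exp_inv leNgt ifF//; apply/negbF; near: y; exact: nbhs_gt0.
  have sn : s != 0 by rewrite gt_eqF.
  have dV := @is_deriveV _ id s 1 1 sn (is_derive_id s (1 : R)).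
  have dN : is_derive s 1 (fun s => - s^-1) (s ^- 2).
    apply: (is_derive_ext (is_deriveN dV)).
    by rewrite /GRing.scale/= mulr1 opprK.
  have dE := @is_derive1_comp _ expR (fun s => - s^-1) s _ _ (is_derive_expR _) dN.
  have dX : is_derive s 1 (fun s => s^-1 ^+ k) (k%:R * s^-1 ^+ k.-1 *: (- s ^- 2 *: 1)).
    by have := is_deriveX k dV; rewrite exprfctE.
  apply: (is_derive_ext (is_deriveM dX dE)).
  rewrite /GRing.scale/= !mulr1; case: k {dX} => [|k].
    by rewrite !expr0 mulr0n; field.
  by rewrite /= -mulr_natl !exprS; field.
- have -> : - k%:R * exp_inv k.+1 0 + exp_inv k.+2 0 = 0 :> R.
    by rewrite /exp_inv lexx; ring.
  (* The difference quotient at 0 is [exp_inv k.+1] itself, and [exp_inv_le] makes it continuous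
     there with value 0. *)
  apply/is_derive1_caratheodory; exists (exp_inv k.+1); split.
  + move=> z; rewrite /exp_inv lexx !subr0; case: ifPn => [_|]; first by rewrite mul0r.
    by rewrite -ltNge => z0; rewrite exprS; field; rewrite gt_eqF.
  + have [C C0 HC] := exp_inv_le k.+1.
    rewrite /prop_for /continuous_at {2}/exp_inv lexx; apply/cvgrPdist_le => e e0.
    near=> z; rewrite sub0r normrN (le_trans (HC z))// mulrC -ler_pdivlMr//.
    near: z; exists (e / C); first exact: divr_gt0.
    by move=> z /=; rewrite sub0r normrN => /ltW.
  + by rewrite /exp_inv lexx.
Unshelve. all: by end_near. Qed.

Lemma n_diff_exp_inv_affine n k (c a : R) :
  n_diff (fun=> True) n (fun x => exp_inv k (c * (x - a))).
Proof.
elim: n k => [//|n IH] k; split => //.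
exists (fun x => c * (- k%:R * exp_inv k.+1 (c * (x - a)) + exp_inv k.+2 (c * (x - a)))).
  move=> x x0; have d : is_derive x 1 (fun x => c * (x - a)) c.
    have d' := is_deriveB (is_derive_id x (1 : R)) (is_derive_cst a x (1 : R)).
    by apply: (is_derive_ext (is_deriveZ c d')); rewrite subr0 /GRing.scale/= mulr1.
  by rewrite mulrC; exact: (@is_derive1_comp _ (exp_inv k) (fun x => c * (x - a)) x _ _
    (is_derive_exp_inv _ _) d).
exact: (n_diffZ (fun _ _ => I) (n_diffD (fun _ _ _ _ => I)
  (n_diffZ (fun _ _ => I) (IH k.+1)) (IH k.+2))).
Qed.

Lemma exp_inv0_gt0 s : 0 < s -> 0 < exp_inv 0 s.
Proof. by move=> s0; rewrite /exp_inv leNgt s0/= mul1r expR_gt0. Qed.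

Lemma exp_inv0_ge0 s : 0 <= exp_inv 0 s.
Proof. by rewrite /exp_inv; case: ifP => // _; rewrite mul1r expR_ge0. Qed.

Lemma exp_inv_le0 k s : s <= 0 -> exp_inv k s = 0.
Proof. by rewrite /exp_inv => ->. Qed.

(** The sign of c gives the direction: for c = 1 and a < b the step is 0 up to a and 1 from b on;
    for c = -1 and b < a it is 1 up to b and 0 from a on. *)
Definition smooth_step (c a b x : R) : R :=
  exp_inv 0 (c * (x - a)) / (exp_inv 0 (c * (x - a)) + exp_inv 0 (- c * (x - b))).

Lemma n_diff_smooth_step n (c a b : R) : 0 < c * (b - a) ->
  n_diff (fun=> True) n (smooth_step c a b).
Proof.
move=> cab; apply: n_diffM => //; first exact: n_diff_exp_inv_affine.
apply: n_diff_inv; last first.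
  by apply: n_diffD => //; exact: n_diff_exp_inv_affine.
(* The arguments of the two exponentials add up to c (b - a) > 0, so at least one is positive. *)
move=> x _; rewrite gt_eqF//; have [h|h] := ltP 0 (c * (x - a)).
  by rewrite ltr_wpDr ?exp_inv0_ge0 ?exp_inv0_gt0.
by rewrite ltr_wpDl ?exp_inv0_ge0 ?exp_inv0_gt0//; lra.
Qed.

Lemma smooth_step0 (c a b x : R) : c * (x - a) <= 0 -> smooth_step c a b x = 0.
Proof. by move=> h; rewrite /smooth_step exp_inv_le0// mul0r. Qed.

Lemma smooth_step1 (c a b x : R) : 0 < c * (b - a) -> 0 <= c * (x - b) ->
  smooth_step c a b x = 1.
Proof.
move=> ab h; rewrite /smooth_step (@exp_inv_le0 _ (- c * (x - b))); last lra.
by rewrite addr0 divff// gt_eqF// exp_inv0_gt0//; lra.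
Qed.

Lemma smooth_cutoff (a a' b' b : R) : a < a' -> b' < b ->
  exists chi : R -> R, [/\ (forall n, n_diff (fun=> True) n chi),
    (forall x, a' <= x <= b' -> chi x = 1) & (forall x, x < a \/ b < x -> chi x = 0)].
Proof.
move=> aa' bb'; exists (fun x => smooth_step 1 a a' x * smooth_step (-1) b b' x); split.
- by move=> n; apply: n_diffM => //; apply: n_diff_smooth_step; lra.
- move=> x /andP[ax xb]; rewrite !smooth_step1 ?mulr1//; lra.
- by move=> x [xa|bx]; [rewrite smooth_step0 ?mul0r//|rewrite mulrC smooth_step0 ?mul0r//]; lra.
Qed.

End smooth_cutoff.

(** * The distribution part *)

Section distribution_part.
Context {R : realType}.
Implicit Types (x y t l xi : R) (f g : R -> R) (n : nat) (z w : R[i]).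

Definition smooth_pos f := forall n, n_diff (fun=> True) n f.

Lemma smooth_posM f g : smooth_pos f -> smooth_pos g -> smooth_pos (fun x => f x * g x).
Proof. by move=> sf sg n; exact: n_diffM. Qed.

Lemma smooth_posZ (c : R) f : smooth_pos f -> smooth_pos (fun x => c * f x).
Proof. by move=> sf n; exact: n_diffZ. Qed.

Lemma smooth_complex f g : smooth_pos f -> smooth_pos g -> smooth (fun x => f x +i* g x).
Proof.
move=> sf sg k x; rewrite RplusE => x0; split.
  exact: (n_diff_derivable (sf k.+1) x0).
exact: (n_diff_derivable (sg k.+1) x0).
Qed.

Lemma n_diff_cos_sin (c : R) n : n_diff (fun=> True) n (fun x => cos (x ^+ 2 * c)) /\
  n_diff (fun=> True) n (fun x => sin (x ^+ 2 * c)).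
Proof.
have d x : is_derive x 1 (fun x => x ^+ 2 * c) (2 * c * x).
  by apply: is_derive_eq; rewrite /GRing.scale/=; ring.
have nid n' : n_diff (fun=> True) n' (fun x => 2 * c * x).
  case: n' => [|n'] //; split => //; exists (cst (2 * c)).
    by move=> x _; have := is_deriveZ (2 * c) (is_derive_id x (1 : R)); rewrite /GRing.scale/= mulr1.
  exact: n_diff_cst.
elim: n => [//|n [IHc IHs]]; split; split => //.
  exists (fun x => -1 * (sin (x ^+ 2 * c) * (2 * c * x))).
    move=> x _; have := @is_derive1_comp _ (@cos R) (fun x => x ^+ 2 * c) x _ _ (is_derive_cos _) (d x).
    by move/is_derive_ext; apply; ring.
  by apply: n_diffZ => //; exact: n_diffM.
exists (fun x => cos (x ^+ 2 * c) * (2 * c * x)).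
  by move=> x _; exact: (@is_derive1_comp _ (@sin R) (fun x => x ^+ 2 * c) x _ _ (is_derive_sin _) (d x)).
exact: n_diffM.
Qed.

Lemma n_diff_inv_bounded (T : R) n : 1 <= T -> n_diff (bounded_from T) n (fun x => x^-1).
Proof.
move=> T1; have b : bounded_from T (fun x => x^-1).
  exists 1 => t Tt; have t1 : 1 <= t by exact: le_trans Tt.
  by rewrite normfV invf_le1 ?normr_gt0 ?gt_eqF// ?ger0_norm//; lra.
elim: n => [//|n IH]; split => //; exists (fun x => -1 * (x^-1 * x^-1)).
  move=> x x0; have xn : x != 0 by rewrite gt_eqF.
  apply: (is_derive_ext (@is_deriveV _ id x 1 1 xn (is_derive_id x (1 : R)))).
  by rewrite /GRing.scale/= expr2 invfM; ring.
apply: n_diffZ.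
  by move=> f [M HM]; exists M => t Tt; rewrite mulN1r normrN; exact: HM.
by apply: n_diffM => //; [exact: bounded_fromD|exact: bounded_fromM].
Qed.

(** Induction on v and v' together: v'' is a combination of v and v / t^2, whose coefficients are
    bounded on t >= T with all their derivatives. The same T serves every order. *)
Lemma n_diff_bessel_sqrt m : 2^-1 <= m ->
  exists T : R, forall n, n_diff (bounded_from T) n (bessel_sqrt m).
Proof.
move=> m_ge; have m0 : 0 < m by lra.
have [T [M [T1 M0 HM]]] := bessel_sqrt_deriv_bounded m_ge; exists T.
have bv : bounded_from T (bessel_sqrt m) by exists M => t /HM[].
have bd : bounded_from T (bessel_sqrt_deriv m) by exists M => t /HM[].
suff H n : n_diff (bounded_from T) n (bessel_sqrt m) /\
    n_diff (bounded_from T) n (bessel_sqrt_deriv m).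
  by move=> n; have [] := H n.
have bZ (c : R) f : bounded_from T f -> bounded_from T (fun x => c * f x).
  by move=> bf; apply: bounded_fromM => //; exists `|c|.
elim: n => [//|n [IH1 IH2]]; split; split => //.
  by exists (bessel_sqrt_deriv m) => // x x0; exact: is_derive_bessel_sqrt.
exists (fun x => (m ^+ 2 - 4^-1) * (x^-1 * x^-1 * bessel_sqrt m x) + -1 * bessel_sqrt m x).
  move=> x x0; apply: (is_derive_ext (is_derive_bessel_sqrt_deriv m0 x0)).
  by rewrite expr2 invfM; ring.
have bD := @bounded_fromD R T; have bM := @bounded_fromM R T.
have ni := @n_diff_inv_bounded T n T1.
by apply: n_diffD => //; [apply: (n_diffZ (bZ _)); apply: n_diffM => //; exact: n_diffM
  |exact: (n_diffZ (bZ _))].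
Qed.

Lemma normc_le (a b : R) : Normc.normc (a +i* b) <= `|a| + `|b|.
Proof.
rewrite /= -[leRHS]ger0_norm ?addr_ge0// -sqrtr_sqr ler_sqrt ?sqr_ge0//.
have := normr_ge0 a; have := normr_ge0 b; rewrite sqrrD !real_normK ?num_real//.
by move: `|a| `|b| => A B B0 A0; have := mulr_ge0 A0 B0; lra.
Qed.

Lemma normc_ge0 z : 0 <= Normc.normc z.
Proof. by case: z => a b /=; exact: sqrtr_ge0. Qed.

Lemma normcR (t : R) : Normc.normc t%:C = `|t|.
Proof. by rewrite /= expr0n/= addr0 sqrtr_sqr. Qed.

Lemma smooth0 : smooth (fun _ : R => 0 : R[i]).
Proof. by apply: (@smooth_complex (cst 0) (cst 0)) => n; exact: n_diff_cst. Qed.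

Lemma supnorm_eq0 (A : set R) (phi : R -> R[i]) : (forall x, A x -> phi x = 0) ->
  (supnorm A phi <= 0)%E.
Proof.
move=> A0; apply: ub_ereal_sup => _ [x Ax <-].
by rewrite A0// Normc.normc0.
Qed.

(* A continuous functional is bounded by one of the seminorms, so it cannot see
   functions vanishing on the corresponding interval. *)
Lemma Edual_support (h : (R -> R[i]) -> R[i]) : Edual h ->
  exists N : nat, forall f g, smooth_pos f -> smooth_pos g ->
    (forall x, (N.+2%:R)^-1 <= x <= N.+2%:R -> f x = 0 /\ g x = 0) ->
    h (fun x => f x +i* g x) = 0.
Proof.
move=> [hlin hcont].
have h0 : h (fun=> 0) = 0.
  have := hlin 1 _ _ smooth0 smooth0; rewrite !mul1r addr0.
  by move/eqP; rewrite -subr_eq0 opprD addrA subrr sub0r oppr_eq0 => /eqP.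
have [N [d [d0 Hd]]] := hcont _ smooth0 1 ltr01.
exists N => f g sf sg fg0; apply/eqP; apply/negPn/negP => hn.
have n0 : 0 < Normc.normc (h (fun x => f x +i* g x)).
  rewrite lt_def normc_ge0 andbT; apply: contra hn => /eqP/Normc.eq0_normc ->//.
(* Rescaled so that its value has modulus 1, the function still has seminorm 0, and continuity at 0
   with tolerance 1 gives 1 < 1. *)
set z := h _ in hn n0; set t := (Normc.normc z)^-1.
have tz : h (fun x => (t * f x) +i* (t * g x)) = t%:C * z.
  have := hlin t%:C _ _ (smooth_complex sf sg) smooth0; rewrite h0 addr0 => <-.
  by congr h; apply/funext => x; apply/eqP; rewrite eq_complex/= !addr0 !mul0r subr0 addr0 !eqxx.
have := Hd _ (smooth_complex (smooth_posZ t sf) (smooth_posZ t sg)).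
rewrite tz h0 subr0 Normc.normcM normcR ger0_norm ?invr_ge0 ?normc_ge0//.
rewrite mulVf ?gt_eqF// => H; suff : (1 : R) < 1 by rewrite ltxx.
apply: H.
apply: (@le_lt_trans _ _ 0%E); last by rewrite lte_fin.
rewrite /Enorm; elim/big_ind : _ => //.
  by move=> x y x0 y0; rewrite ge_max x0.
move=> k _; apply: supnorm_eq0 => x; rewrite /= in_itv/= => /andP[x1 x2].
(* The seminorm looks at [1/(N+1), N+1], which lies in the interior of [1/(N+2), N+2]; hence the
   derivatives vanish there too, not only the functions. *)
have lt1 : N.+2%:R^-1 < x.
  by rewrite (lt_le_trans _ x1)// ltf_pV2 ?posrE ?ltr0n// ltr_nat.
have lt2 : x < N.+2%:R by rewrite (le_lt_trans x2)// ltr_nat.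
by rewrite /Dn !(@derive1n_locally0 _ _ N.+2%:R^-1 N.+2%:R)// => y y1 y2 /=;
  have [fy gy] := fg0 y (introT andP (conj (ltW y1) (ltW y2))); rewrite ?fy ?gy mulr0 subr0.
Qed.

Lemma expiD (s t : R) : expi (s + t) = expi s * expi t.
Proof. by rewrite /expi cosD sinD; apply/eqP; rewrite eq_complex/= eqxx addrC eqxx. Qed.

Lemma normc_expi (t : R) : Normc.normc (expi t) = 1.
Proof. by rewrite /= cos2Dsin2 sqrtr1. Qed.

Lemma KalphaE (alpha m x xi : R) : Kalpha alpha m x xi =
  Calpha alpha m * expi (- (xi ^+ 2 * c1 alpha / 2)) *
  (expi (- (x ^+ 2 * c1 alpha / 2)) * (bessel_sqrt m (xi * c2 alpha * x))%:C).
Proof.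
rewrite /Kalpha /bessel_sqrt (_ : x * xi * c2 alpha = xi * c2 alpha * x); last by ring.
rewrite (_ : - ((x ^+ 2 + xi ^+ 2) / 2 * c1 alpha) =
  - (xi ^+ 2 * c1 alpha / 2) - x ^+ 2 * c1 alpha / 2); last by ring.
by rewrite expiD !mulrA.
Qed.

Lemma smooth_bessel_sqrt m l : 2^-1 <= m -> 0 < l ->
  smooth_pos (fun x => bessel_sqrt m (l * x)).
Proof.
move=> m_ge l0 n; have [T HT] := n_diff_bessel_sqrt m_ge.
apply: (n_diff_scale (f := bessel_sqrt m)) => //.
elim: n (bessel_sqrt m) (HT n) => [//|n IH] f [_ [f' df nf]]; split=> //.
by exists f' => //; exact: IH.
Qed.

Lemma Dspace_supported (a b : R) f g : 0 < a -> smooth_pos f -> smooth_pos g ->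
  (forall x, x < a \/ b < x -> f x = 0 /\ g x = 0) -> Dspace (fun x => f x +i* g x).
Proof.
move=> a0 sf sg fg0; split; first exact: smooth_complex.
exists `[a, b]%classic; split; first exact: segment_compact.
  by move=> x /=; rewrite RplusE in_itv/= => /andP[ax _]; exact: lt_le_trans ax.
move=> x _ /=; rewrite in_itv/= => /negP; rewrite negb_and -!ltNge => /orP xab.
by have [-> ->] := fg0 x xab.
Qed.

Lemma FrHT_dist_le alpha m (h : (R -> R[i]) -> R[i]) r :
  0 < alpha < pi -> 2^-1 <= m -> Edual h -> order_bound h r ->
  exists C L : R, forall xi, L <= xi ->
    Normc.normc (FrHT_dist alpha m h xi) <= C * (xi * c2 alpha) ^+ r.
Proof.
move=> alpha0pi m_ge hE [C0 HC0].
have c20 : 0 < c2 alpha by rewrite /c2 invr_gt0 sin_gt0_pi.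
have [N HN] := Edual_support hE; have [T HT] := n_diff_bessel_sqrt m_ge.
(* A strictly larger interval than the one on which chi must equal 1, leaving room for the cut-off
   to descend to 0. *)
pose a : R := N.+3%:R^-1; pose b : R := N.+3%:R.
have a0 : 0 < a by rewrite invr_gt0 ltr0n.
have ab : a <= b.
  by rewrite (@le_trans _ _ 1)// ?ler1n// invf_le1 ?ler1n// ltr0n.
have [chi [schi chi1 chi0]] : exists chi : R -> R, [/\ smooth_pos chi,
    (forall x, N.+2%:R^-1 <= x <= N.+2%:R -> chi x = 1) & (forall x, x < a \/ b < x -> chi x = 0)].
  by apply: smooth_cutoff; rewrite ?ltf_pV2 ?posrE ?ltr0n// ltr_nat.
pose co x := cos (x ^+ 2 * (c1 alpha / 2)); pose si x := - 1 * sin (x ^+ 2 * (c1 alpha / 2)).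
have sco : smooth_pos co by move=> n; have [] := n_diff_cos_sin (c1 alpha / 2) n.
have ssi : smooth_pos si.
  by move=> n; apply: n_diffZ => //; have [] := n_diff_cos_sin (c1 alpha / 2) n.
have bnd u : smooth_pos u -> exists2 C : R, 0 <= C & forall l x, 1 <= l -> T <= l * a -> 0 < x ->
    `|derive1n r (fun x => chi x * u x * bessel_sqrt m (l * x)) x| <= C * l ^+ r.
  move=> su; apply: (@derive1n_dilated_le R a b _ _ _ _ a0 _ (HT r)); apply: n_diff_supported_in => //.
    by move=> x _ xab; rewrite chi0 ?mul0r.
  exact: smooth_posM.
have [C1 C10 HC1] := bnd _ sco; have [C2 C20 HC2] := bnd _ ssi.
(* The two thresholds on xi ensure l >= 1 and T <= l a. The absolute value is taken because the
   constant of the order bound may have any sign. *)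
exists (Normc.normc (Calpha alpha m) * (`|C0| * (C1 + C2))), (Num.max (c2 alpha)^-1 (T / a / c2 alpha)).
move=> xi; rewrite ge_max => /andP[xi1 xi2].
set l := xi * c2 alpha.
have l1 : 1 <= l by rewrite /l -ler_pdivrMr// mul1r.
have Tl : T <= l * a by rewrite -ler_pdivrMr// /l -ler_pdivrMr.
have l0 : 0 < l by lra.
have sv := smooth_bessel_sqrt m_ge l0.
pose v x := bessel_sqrt m (l * x).
pose chi' x := 1 + -1 * chi x.
have schi' : smooth_pos chi'.
  by move=> n; apply: n_diffD => //; [exact: n_diff_cst|exact: n_diffZ].
have sk u : smooth_pos u -> smooth_pos (fun x => chi x * u x * v x).
  by move=> su; apply: smooth_posM sv; exact: smooth_posM.
have sk' u : smooth_pos u -> smooth_pos (fun x => chi' x * u x * v x).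
  by move=> su; apply: smooth_posM sv; exact: smooth_posM.
have [hlin _] := hE.
(* The kernel is split as chi plus 1 - chi times itself; the second part vanishes on the interval
   seen by h, so [Edual_support] discards it. *)
have kE : FrHT_dist alpha m h xi = Calpha alpha m * expi (- (xi ^+ 2 * c1 alpha / 2)) *
    h (fun x => (chi x * co x * v x) +i* (chi x * si x * v x)).
  have hsplit := hlin 1 _ _ (smooth_complex (sk _ sco) (sk _ ssi))
    (smooth_complex (sk' _ sco) (sk' _ ssi)).
  rewrite [X in _ + X]HN in hsplit; [|exact: sk'|exact: sk'|]; last first.
    by move=> x /chi1 chix; rewrite /chi' chix mulr1 subrr !mul0r.
  have h0 := hlin (Calpha alpha m * expi (- (xi ^+ 2 * c1 alpha / 2))) _ _
    (smooth_complex (smooth_posM sco sv) (smooth_posM ssi sv))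
    (smooth_complex (fun n => n_diff_cst (c := 0) n I I) (fun n => n_diff_cst (c := 0) n I I)).
  rewrite [X in _ + X]HN in h0; [|by move=> n; exact: n_diff_cst|by move=> n; exact: n_diff_cst|by []].
  rewrite mul1r !addr0 in hsplit h0; rewrite -hsplit.
  rewrite (_ : (fun x => 1 * _ + _) = (fun x => (co x * v x) +i* (si x * v x))).
    rewrite -h0 /FrHT_dist; congr h; apply/funext => x; rewrite addr0 KalphaE; congr (_ * _).
    rewrite /co /si /v -/l /expi cosN sinN mulrA.
    by apply/eqP; rewrite eq_complex/= !mulr0 subr0 add0r mulN1r !eqxx.
  apply/funext => x; apply/eqP; rewrite mul1r eq_complex/= /chi'.
  by apply/andP; split; apply/eqP; ring.
rewrite kE Normc.normcM (Normc.normcM (Calpha alpha m)) normc_expi mulr1 -!mulrA ler_wpM2l ?normc_ge0//.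
have D : Dspace (fun x => (chi x * co x * v x) +i* (chi x * si x * v x)).
  apply: (@Dspace_supported a b) => //; [exact: sk|exact: sk|].
  by move=> x /chi0 ->; rewrite !mul0r.
have := HC0 _ D; set S := supnorm _ _ => HS.
(* The sign of the supremum is needed to replace [C0] by its absolute value; the set is nonempty, as
   the point x = 1 shows. *)
have S0 : (0 <= S)%E.
  apply: (@le_trans _ _ (Normc.normc (Dn r (fun x => (chi x * co x * v x) +i* (chi x * si x * v x)) 1))%:E).
    by rewrite lee_fin normc_ge0.
  by apply: ereal_sup_ubound; exists 1 => //=; rewrite RplusE.
have SC : (S <= ((C1 + C2) * l ^+ r)%:E)%E.
  apply: ub_ereal_sup => _ [x xp <-]; rewrite lee_fin.
  have x0 : 0 < x by move: xp; rewrite RplusE.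
  apply: (le_trans (normc_le _ _)); rewrite mulrDl lerD//; [exact: HC1|exact: HC2].
rewrite -lee_fin; apply: (le_trans HS).
apply: (@le_trans _ _ (`|C0|%:E * S)%E); first by rewrite lee_wpmul2r// lee_fin ler_norm.
by rewrite EFinM lee_wpmul2l// lee_fin.
Qed.

End distribution_part.

(** * The complex-valued limit *)

Section complex_valued.
Context {R : realType}.
Local Notation mu := (@lebesgue_measure R).
Implicit Types (x t e : R) (z w : R[i]).

Lemma normcE_complex z : `|z| = (Normc.normc z)%:C.
Proof. by case: z. Qed.

(** The norm of [R[i]^o] is itself complex-valued, but a positive radius in [R[i]] has zero
    imaginary part, so real radii suffice. *)
Lemma cvg_normcP (T : Type) (F : set_system T) (FF : Filter F) (f : T -> R[i]) z :
  f x @[x --> F] --> (z : R[i]^o) <->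
  forall e, 0 < e -> \forall x \near F, Normc.normc (z - f x) < e.
Proof.
split=> [/(@cvgrPdist_lt _ R[i]^o) H e e0|H].
  have := H e%:C; rewrite ltcR => /(_ e0); apply: filterS => x.
  by rewrite normcE_complex ltcR.
apply/(@cvgrPdist_lt _ R[i]^o) => e; rewrite ltcE => /andP[/eqP Ie e0].
apply: filterS (H _ e0) => x fx.
by rewrite normcE_complex ltcE/= Ie eqxx.
Qed.

Lemma Re_le_normc z : `|complex.Re z| <= Normc.normc z.
Proof.
case: z => a b /=; rewrite -sqrtr_sqr ler_sqrt ?addr_ge0 ?sqr_ge0//.
by rewrite lerDl sqr_ge0.
Qed.

Lemma Im_le_normc z : `|complex.Im z| <= Normc.normc z.
Proof.
case: z => a b /=; rewrite -sqrtr_sqr ler_sqrt ?addr_ge0 ?sqr_ge0//.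
by rewrite lerDr sqr_ge0.
Qed.

Lemma cvg_complex_Re (T : Type) (F : set_system T) (FF : Filter F) (f : T -> R[i]) z :
  f x @[x --> F] --> (z : R[i]^o) -> complex.Re (f x) @[x --> F] --> complex.Re z.
Proof.
move=> /cvg_normcP H; apply/cvgrPdist_lt => e /H; apply: filterS => x.
by apply: le_lt_trans; rewrite -raddfB; exact: Re_le_normc.
Qed.

Lemma cvg_complex_Im (T : Type) (F : set_system T) (FF : Filter F) (f : T -> R[i]) z :
  f x @[x --> F] --> (z : R[i]^o) -> complex.Im (f x) @[x --> F] --> complex.Im z.
Proof.
move=> /cvg_normcP H; apply/cvgrPdist_lt => e /H; apply: filterS => x.
by apply: le_lt_trans; rewrite -raddfB; exact: Im_le_normc.
Qed.

Lemma cintegralZl (A : set R) z (f g : R -> R) : measurable A ->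
  mu.-integrable A (EFin \o f) -> mu.-integrable A (EFin \o g) ->
  cintegral A (fun x => z * (f x +i* g x)) =
  z * (\int[mu]_(x in A) f x +i* \int[mu]_(x in A) g x).
Proof.
case: z => a b mA fi gi; apply/eqP; rewrite eq_complex/=; apply/andP; split; apply/eqP.
  by rewrite RintegralB ?RintegralZl//; exact: integrableZl_EFin.
by rewrite RintegralD ?RintegralZl//; exact: integrableZl_EFin.
Qed.

Lemma cmeasurable_expiM (q : R) (g : R -> R[i]) : cmeasurable (@Rplus R) g ->
  cmeasurable (@Rplus R) (fun x => expi (- (x ^+ 2 * q)) * g x).
Proof.
move=> [m1 m2].
have cq (u : R -> R) : (forall t, {for t, continuous u}) ->
    measurable_fun (@Rplus R) (fun x => u (- (x ^+ 2 * q))).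
  move=> cu; apply: continuous_Rplus_measurable => x x0.
  apply: (@continuous_fun_comp _ (fun x => - (x ^+ 2 * q)) u) => //.
  apply: is_derive_continuous (_ : is_derive x 1 _ (- (2 * q * x))).
  by apply: is_derive_eq; rewrite /GRing.scale/=; ring.
have mcos := cq _ (@continuous_cos R); have msin := cq _ (@continuous_sin R).
have E x : expi (- (x ^+ 2 * q)) * g x =
    (cos (- (x ^+ 2 * q)) * complex.Re (g x) - sin (- (x ^+ 2 * q)) * complex.Im (g x)) +i*
    (cos (- (x ^+ 2 * q)) * complex.Im (g x) + sin (- (x ^+ 2 * q)) * complex.Re (g x)).
  by case: (g x) => a b; apply/eqP; rewrite eq_complex/= !eqxx.
split; under eq_fun do rewrite /= E /=.
  by apply: measurable_funB; apply: measurable_funM.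
by apply: measurable_funD; apply: measurable_funM.
Qed.

Lemma cintegrable_expiM (q X : R) (g : R -> R[i]) : 0 < X -> cmeasurable (@Rplus R) g ->
  cintegrable `]X, +oo[ g -> cintegrable `]X, +oo[ (fun x => expi (- (x ^+ 2 * q)) * g x).
Proof.
move=> X0 mg [i1 i2]; have [m1 m2] := cmeasurable_expiM q mg.
have sub : `]X, +oo[ `<=` @Rplus R.
  by move=> x /=; rewrite RplusE in_itv/= andbT; exact: lt_trans.
have iN : mu.-integrable `]X, +oo[
    (EFin \o (fun x => `|complex.Re (g x)| + `|complex.Im (g x)|)).
  apply: (@eq_integrable _ _ _ mu _ _ (fun x => `|(complex.Re (g x))%:E| + `|(complex.Im (g x))%:E|)%E) => //.
  by apply: integrableD => //; exact: integrable_abse.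
have le x : Normc.normc (expi (- (x ^+ 2 * q)) * g x) <= `|complex.Re (g x)| + `|complex.Im (g x)|.
  by rewrite Normc.normcM normc_expi mul1r; case: (g x) => a b; exact: normc_le.
split; apply: (le_integrable_EFin _ _ iN) => //.
- by apply: measurable_funS m1 => //; exact: measurable_Rplus.
- by move=> x _; apply: le_trans (Re_le_normc _) (le x).
- by apply: measurable_funS m2 => //; exact: measurable_Rplus.
- by move=> x _; apply: le_trans (Im_le_normc _) (le x).
Qed.

End complex_valued.

(** * Assembling the limit of the transform *)

Lemma powRN_cvg0 (R : realType) (p : R) : p < 0 -> x `^ p @[x --> +oo] --> (0 : R).
Proof.
move=> p0; have np : 0 < - p by rewrite oppr_gt0.
have H := gtr0_cvgV0 (f := fun x : R => x `^ (- p)).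
have : (x `^ (- p))^-1 @[x --> +oo] --> (0 : R).
  apply/H.
    by near=> x; apply: powR_gt0; near: x; exact: nbhs_pinfty_gt.
  exact: powR_cvgy.
apply: cvg_trans; apply: near_eq_cvg; near=> x; rewrite powRN invrK//.
Unshelve. all: by end_near. Qed.

Lemma le_normcB (R : realType) (z w : R[i]) :
  Normc.normc (z - w) <= Normc.normc z + Normc.normc w.
Proof.
by rewrite -lecR rmorphD/= -!normcE_complex ler_normB.
Qed.

(** With the phase in x moved onto g, the remaining kernel v(l x) is real, so real and imaginary
    parts are integrated separately. *)
Lemma FrHT_funE (R : realType) (alpha m xi : R) (g : R -> R[i]) :
  let gt x := expi (- (x ^+ 2 * c1 alpha / 2)) * g x in
  let l := xi * c2 alpha in
  (@lebesgue_measure R).-integrable (@Rplus R)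
    (EFin \o (fun x => bessel_sqrt m (l * x) * complex.Re (gt x))) ->
  (@lebesgue_measure R).-integrable (@Rplus R)
    (EFin \o (fun x => bessel_sqrt m (l * x) * complex.Im (gt x))) ->
  FrHT_fun alpha m g xi = Calpha alpha m * expi (- (xi ^+ 2 * c1 alpha / 2)) *
    ((\int[lebesgue_measure]_(x in @Rplus R) (bessel_sqrt m (l * x) * complex.Re (gt x))) +i*
     (\int[lebesgue_measure]_(x in @Rplus R) (bessel_sqrt m (l * x) * complex.Im (gt x)))).
Proof.
move=> gt l i1 i2; rewrite -(cintegralZl _ (measurable_Rplus) i1 i2).
rewrite /FrHT_fun; congr cintegral; apply/funext => x.
rewrite KalphaE -/l -mulrA; congr (_ * _); rewrite mulrAC -/(gt x).
case: (gt x) => a b; apply/eqP; rewrite eq_complex/=; apply/andP; split; apply/eqP; ring.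
Qed.

Lemma Calpha_neq0 (R : realType) (alpha m : R) : 0 < alpha < pi -> Calpha alpha m != 0.
Proof.
move=> alpha0pi; apply: mulf_neq0; last first.
  by rewrite invr_eq0 -(rmorph0 (real_complex R)) (inj_eq (@complexI R)) gt_eqF// sin_gt0_pi.
apply/eqP => e0; have := normc_expi ((1 + m) * (pi / 2 - alpha)).
by rewrite e0 Normc.normc0 => /eqP; rewrite eq_sym oner_eq0.
Qed.

Theorem theorem5p4 (R : realType) (alpha mu eta : R) (r : nat)
    (f h : (R -> R[i]) -> R[i]) (g : R -> R[i]) (rho : R[i])
    (halpha : 0 < alpha < pi)
    (hmu : 1 / 2 <= mu)
    (heta : 3 / 2 + r%:R < eta < 2 + mu)
    (hf : Kdual mu f)
    (hh : Edual h)
    (hr : has_order h r)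
    (hfgh : forall phi : R -> R[i], Kspace mu phi ->
       f phi = cintegral (@Rplus R) (fun x => g x * phi x) + h phi)
    (hgm : cmeasurable (@Rplus R) g)
    (hgint : forall X : R, 0 < X -> cintegrable `]X, +oo[ g)
    (hg0 : g x @[x --> +oo] --> (0 : R[i]^o))
    (hgac : exists F : R -> R[i],
       (forall X : R, 0 < X -> abs_continuous `[0, X] F) /\
       (forall x : R, Rplus x -> F x = (x `^ (eta - 1 / 2))%:C * g x))
    (hrho : expi (- (x ^+ 2 * c1 alpha / 2)) * (x `^ (eta - 1 / 2))%:C * g x
              @[x --> 0^'+] -->
            (rho * (c2 alpha `^ (3 / 2 - eta))%:C / Calpha alpha mu : R[i]^o)) :
  expi (xi ^+ 2 * c1 alpha / 2) * (xi `^ (3 / 2 - eta))%:C *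
    (FrHT_fun alpha mu g xi + FrHT_dist alpha mu h xi)
    @[xi --> +oo] --> (rho * (Hconst mu eta)%:C : R[i]^o).
Proof.
have m_ge : 2^-1 <= mu by rewrite -div1r.
have c20 : 0 < c2 alpha by rewrite /c2 invr_gt0 sin_gt0_pi.
have [eta1 eta2] : 3 / 2 < eta /\ eta < 2 + mu.
  by move: heta => /andP[h1 h2]; split => //; have := ler0n R r; lra.
have C0 := Calpha_neq0 mu halpha.
pose q := c1 alpha / 2.
pose gt x := expi (- (x ^+ 2 * q)) * g x.
have gtE x : expi (- (x ^+ 2 * c1 alpha / 2)) * g x = gt x by rewrite /gt /q mulrA.
have [mg1 mg2] := cmeasurable_expiM q hgm.
have ig (X : R) (X0 : 0 < X) := cintegrable_expiM q X0 hgm (@hgint X X0).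
set L := rho * _ / _ in hrho.
have hL : (x `^ (eta - 2^-1))%:C * gt x @[x --> 0^'+] --> (L : R[i]^o).
  apply: cvg_trans hrho; apply: near_eq_cvg; apply: nearW => x.
  by rewrite div1r -gtE -mulrA mulrCA.
have ReZ (a : R) z : complex.Re (a%:C * z) = a * complex.Re z by case: z => z1 z2 /=; rewrite mul0r subr0.
have ImZ (a : R) z : complex.Im (a%:C * z) = a * complex.Im z by case: z => z1 z2 /=; rewrite mul0r addr0.
have hL1 : x `^ (eta - 2^-1) * complex.Re (gt x) @[x --> 0^'+] --> complex.Re L.
  by apply: cvg_trans (cvg_complex_Re _ hL); apply: near_eq_cvg; apply: nearW => x; rewrite ReZ.
have hL2 : x `^ (eta - 2^-1) * complex.Im (gt x) @[x --> 0^'+] --> complex.Im L.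
  by apply: cvg_trans (cvg_complex_Im _ hL); apply: near_eq_cvg; apply: nearW => x; rewrite ImZ.
have i1 (X : R) (X0 : 0 < X) := (ig X X0).1; have i2 (X : R) (X0 : 0 < X) := (ig X X0).2.
have ik1 := integrable_bessel_kernel m_ge eta1 eta2 mg1 i1 hL1.
have ik2 := integrable_bessel_kernel m_ge eta1 eta2 mg2 i2 hL2.
have ck1 := cvg_bessel_kernel m_ge eta1 eta2 mg1 i1 hL1.
have ck2 := cvg_bessel_kernel m_ge eta1 eta2 mg2 i2 hL2.
set J1 := (fun l : R => l `^ (3 / 2 - eta) * _) in ck1.
set J2 := (fun l : R => l `^ (3 / 2 - eta) * _) in ck2.
have cl : xi * c2 alpha @[xi --> +oo] --> +oo.
  by apply: gt0_cvgMly => //; exact: cvg_id.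
have ck1' := cvg_comp _ _ cl ck1; have ck2' := cvg_comp _ _ cl ck2.
(* The real results are stated in l = xi c2, while the claim has xi^(3/2 - eta) = l^(3/2 - eta) /
   c2^(3/2 - eta); k collects this constant and C_(alpha,mu). The normalisation of rho is such that
   k L = rho. *)
pose k := Calpha alpha mu / (c2 alpha `^ (3 / 2 - eta))%:C.
have p0 : 0 < c2 alpha `^ (3 / 2 - eta) by exact: powR_gt0.
have rhoE : rho * (Hconst mu eta)%:C =
    k * ((complex.Re L * Hconst mu eta) +i* (complex.Im L * Hconst mu eta)).
  have -> : (complex.Re L * Hconst mu eta) +i* (complex.Im L * Hconst mu eta) = L * (Hconst mu eta)%:C.
    by case: (L) => a b; apply/eqP; rewrite eq_complex/= !mulr0 subr0 add0r !eqxx.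
  rewrite mulrA; congr (_ * _); rewrite /k /L.
  have p0' : (c2 alpha `^ (3 / 2 - eta))%:C != 0 by rewrite fmorph_eq0 gt_eqF.
  by move: (Calpha _ _) (_%:C) C0 p0' => C P C0 P0; field; rewrite C0 P0.
have [C [X0 HC]] := FrHT_dist_le halpha m_ge hh hr.1.
(* The contribution of h is O(xi^(3/2 - eta + r)), and the exponent is negative exactly because 3/2
   + r < eta. *)
have ds : C * c2 alpha ^+ r * xi `^ (3 / 2 - eta + r%:R) @[xi --> +oo] --> (0 : R).
  rewrite -[X in _ --> X](mulr0 (C * c2 alpha ^+ r)).
  by apply: cvgMr; apply: powRN_cvg0; move: heta => /andP[]; lra.
apply/cvg_normcP => e e0.
have e3 : 0 < e / 3 by lra.
have k0 : 0 < Normc.normc k + 1 by have := normc_ge0 k; lra.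
have d0 : 0 < e / 3 / (Normc.normc k + 1) by exact: divr_gt0.
near=> xi.
have xi0 : 0 < xi by near: xi; exact: nbhs_pinfty_gt.
have X0xi : X0 <= xi by near: xi; apply: nbhs_pinfty_ge; exact: num_real.
have l0 : 0 < xi * c2 alpha by rewrite mulr_gt0.
have n1 : `|complex.Re L * Hconst mu eta - J1 (xi * c2 alpha)| < e / 3 / (Normc.normc k + 1).
  by near: xi; exact: cvgr_dist_lt ck1' _ d0.
have n2 : `|complex.Im L * Hconst mu eta - J2 (xi * c2 alpha)| < e / 3 / (Normc.normc k + 1).
  by near: xi; exact: cvgr_dist_lt ck2' _ d0.
have n3 : C * c2 alpha ^+ r * xi `^ (3 / 2 - eta + r%:R) < e / 3.
  rewrite (le_lt_trans (ler_norm _))// -normrN -sub0r.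
  by near: xi; exact: cvgr_dist_lt ds _ e3.
have fE : expi (xi ^+ 2 * c1 alpha / 2) * (xi `^ (3 / 2 - eta))%:C * FrHT_fun alpha mu g xi =
    k * (J1 (xi * c2 alpha) +i* J2 (xi * c2 alpha)).
  rewrite FrHT_funE; [|by under eq_fun do rewrite gtE; exact: ik1
                      |by under eq_fun do rewrite gtE; exact: ik2].
  under eq_Rintegral do rewrite gtE.
  under [X in _ +i* X]eq_Rintegral do rewrite gtE.
  rewrite /J1 /J2 /gt; set I1 := Rintegral _ _ _; set I2 := Rintegral _ _ _.
  have -> : ((xi * c2 alpha) `^ (3 / 2 - eta) * I1) +i* ((xi * c2 alpha) `^ (3 / 2 - eta) * I2) =
      ((xi * c2 alpha) `^ (3 / 2 - eta))%:C * (I1 +i* I2).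
    by apply/eqP; rewrite eq_complex/= !mul0r subr0 addr0 !eqxx.
  rewrite powRM ?(ltW xi0) ?(ltW c20)// rmorphM/= /k.
  (* The phase in front of the transform undoes the phase in xi of the kernel. *)
  have : expi (xi ^+ 2 * c1 alpha / 2) * expi (- (xi ^+ 2 * c1 alpha / 2)) = 1.
    by rewrite -expiD subrr /expi cos0 sin0.
  have p0' : (c2 alpha `^ (3 / 2 - eta))%:C != 0 by rewrite fmorph_eq0 gt_eqF.
  move: (Calpha _ _) (I1 +i* I2) (expi _) (expi _) (_%:C) (_%:C) p0' => A I E1 E2 P Q Q0 E12.
  by rewrite -[RHS]mulr1 -E12; field.
rewrite mulrDr fE rhoE opprD addrA -mulrBr.
apply: (le_lt_trans (le_normcB _ _)).
(* One third each for the real part, for the imaginary part and for h; the first two errors are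
   divided beforehand by |k| + 1, since both are multiplied by k. *)
have -> : e = e / 3 + e / 3 + e / 3 by field.
apply: ltrD.
  have := normc_le (complex.Re L * Hconst mu eta - J1 (xi * c2 alpha))
    (complex.Im L * Hconst mu eta - J2 (xi * c2 alpha)).
  rewrite Normc.normcM => /(ler_wpM2l (normc_ge0 k))/le_lt_trans; apply.
  have kd : (Normc.normc k + 1) * (e / 3 / (Normc.normc k + 1)) = e / 3.
    by rewrite mulrC divfK ?gt_eqF.
  have := ler_wpM2l (normc_ge0 k) (lerD (ltW n1) (ltW n2)); lra.
rewrite !Normc.normcM normc_expi mul1r normcR ger0_norm ?powR_ge0//.
apply: le_lt_trans n3.
rewrite mulrC (le_trans (ler_wpM2r _ (HC _ X0xi))) ?powR_ge0// (@powRD _ xi (3 / 2 - eta) r%:R) ?(gt_eqF xi0) ?implybT//.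
rewrite powR_mulrn ?(ltW xi0)// exprMn le_eqVlt; apply/orP; left; apply/eqP; ring.
Unshelve. all: by end_near. Qed.
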